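(* Let $e_6=(0,0,0,0,0,1)$ and let $$U_A=\langle(1,2,3,4,5,0),e_6\rangle_{\mathbb R},\qquad U_B=\langle(1,3,4,5,9,0),e_6\rangle_{\mathbb R},\qquad U_C=\langle(1,0,1,2,3,3),(0,1,1,1,1,2)\rangle_{\mathbb R},$$ three two-dimensional subtori of $\mathbb T^6$. Then, up to permutations and sign changes of the coordinates, the two-dimensional proper subtori $U\subseteq\mathbb T^6$ with $D(U)=1/3$ are exactly $U_A$, $U_B$ and $U_C$. That is: each of $U_A,U_B,U_C$ is a two-dimensional proper subtorus with $D=1/3$, and every two-dimensional proper subtorus $U\subseteq \mathbb T^6$ with $D(U)=1/3$ is mapped to one of $U_A,U_B,U_C$ by some permutation and sign change of the coordinates.
   Context: For a real number $x$, $\lVert x\rVert$ is the distance from $x$ to the nearest integer. $\mathbb T^n=(\mathbb R/\mathbb Z)^n$. For a closed subset $X\subseteq\mathbb T^n$ put $\mathrm{ML}(X)=\sup_{x\in X}\min_{1\le r\le n}\lVert x_r\rVert$ and $D(X)=\tfrac12-\mathrm{ML}(X)$ (the $L^\infty$-distance from $X$ to the point $(1/2,\dots,1/2)$). For linearly independent integer vectors $u,v\in\mathbb Z^n$, $\langle u,v\rangle_{\mathbb R}$ denotes the image in $\mathbb T^n$ of the real plane spanned by $u,v$; the two-dimensional subtori of $\mathbb T^n$ are exactly the sets of this form. A subtorus is proper if it is not contained in the union of the coordinate hyperplanes $\{x_r=0\}$, equivalently if $D<1/2$. *)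

(* Defs.v *)
From HB Require Import structures.
From mathcomp Require Import all_boot all_order perm all_algebra.
From mathcomp Require Import boolp classical_sets reals.

Set Implicit Arguments.
Unset Strict Implicit.
Unset Printing Implicit Defensive.

Import Order.TTheory GRing.Theory Num.Theory.

Local Open Scope classical_set_scope.
Local Open Scope ring_scope.
Local Open Scope quotient_scope.

Definition int_subgroup (R : realType) : {pred R} := fun x => x \is a Num.int.

Fact int_subgroup_closed (R : realType) : zmod_closed (@int_subgroup R).
Proof. by split=> [|x y]; [exact: rpred0 | exact: rpredB]. Qed.

HB.instance Definition _ (R : realType) :=
  GRing.isZmodClosed.Build R (@int_subgroup R) (@int_subgroup_closed R).

(* R/Z as an additive group; despite its name, [{ideal_quot _}] is the quotient
   of a zmodType by any subgroup. *)
Notation circle R := {ideal_quot (@int_subgroup R)}.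
Notation torus R n := 'rV[circle R]_n.

Definition dist_int (R : realType) (x : R) : R :=
  inf [set `|x - m%:~R| | m in [set: int]].

(* Independent of the representative, see [circle_norm_pi]. *)
Definition circle_norm (R : realType) (x : circle R) : R := dist_int (repr x).

Lemma circle_norm_pi (R : realType) (x : R) :
  circle_norm (\pi_(circle R) x) = dist_int x.
Proof.
rewrite /circle_norm /dist_int; set y := repr _.
have /intrP[k yxk] : y - x \is a Num.int.
  by rewrite (Quotient.idealrBE (@int_subgroup R)) reprK.
have {yxk}-> : y = x + k%:~R by rewrite -yxk addrCA subrr addr0.
congr inf; apply/seteqP; split=> _ /= [m _ <-].
  by exists (m - k) => //; rewrite rmorphB /= opprB addrA.
exists (m + k) => //.
by rewrite rmorphD /= opprD addrACA subrr addr0.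
Qed.

(* The default value 1/2 is an upper bound of [circle_norm], so that it does
   not affect the minimum as soon as n > 0. *)
Definition min_norm (R : realType) (n : nat) (x : torus R n) : R :=
  \big[Num.min/2^-1]_(r < n) circle_norm (x 0 r).

Definition ML (R : realType) (n : nat) (X : set (torus R n)) : R :=
  sup [set min_norm x | x in X].

Definition D (R : realType) (n : nat) (X : set (torus R n)) : R :=
  2^-1 - ML X.

Definition torus_proj (R : realType) (n : nat) (y : 'rV[R]_n) : torus R n :=
  map_mx \pi_(circle R) y.

Definition real_row (R : realType) (n : nat) (u : 'rV[int]_n) : 'rV[R]_n :=
  map_mx intr u.

Definition plane (R : realType) (n : nat) (u v : 'rV[int]_n) :
    set (torus R n) :=
  [set torus_proj (s *: real_row R u + t *: real_row R v)
    | s in [set: R] & t in [set: R]].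
Arguments plane R {n} u v.

Definition subtorus2 (R : realType) (n : nat) (U : set (torus R n)) : Prop :=
  exists u v : 'rV[int]_n,
    free [:: real_row R u; real_row R v] /\ U = plane R u v.

Definition proper_subtorus (R : realType) (n : nat) (U : set (torus R n)) : Prop :=
  ~ (U `<=` [set x | exists r : 'I_n, x 0 r = 0]).

(* Coordinate r of the image is the coordinate s r of x, negated when eps r. *)
Definition signed_perm (R : realType) (n : nat) (s : 'S_n)
    (eps : {ffun 'I_n -> bool}) (x : torus R n) : torus R n :=
  \row_r (if eps r then - x 0 (s r) else x 0 (s r)).

Definition row6 (w : seq int) : 'rV[int]_6 := \row_r w`_r.

Definition U_A (R : realType) : set (torus R 6) :=
  plane R (row6 [:: 1; 2; 3; 4; 5; 0]) (row6 [:: 0; 0; 0; 0; 0; 1]).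

Definition U_B (R : realType) : set (torus R 6) :=
  plane R (row6 [:: 1; 3; 4; 5; 9; 0]) (row6 [:: 0; 0; 0; 0; 0; 1]).

Definition U_C (R : realType) : set (torus R 6) :=
  plane R (row6 [:: 1; 0; 1; 2; 3; 3]) (row6 [:: 0; 1; 1; 1; 1; 2]).

Arguments U_A R : clear implicits.
Arguments U_B R : clear implicits.
Arguments U_C R : clear implicits.

(* Main.v *)
Require Import Defs.
From HB Require Import structures.
From mathcomp Require Import all_boot all_order perm all_algebra.
From mathcomp Require Import boolp classical_sets reals.
From mathcomp Require Import zify ring lra.

Set Implicit Arguments.
Unset Strict Implicit.
Unset Printing Implicit Defensive.

Import Order.TTheory GRing.Theory Num.Theory.

(** A point of the subtorus spanned by u and v has coordinates s u_r + t v_r, so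
the subtorus is a configuration of six columns (u_r, v_r) in the plane, taken up
to linear changes of coordinates, order and signs. As D = 1/2 - ML, the task is
to find the configurations without zero column whose plane nowhere has all six
coordinates at distance more than 1/6 from the integers, and to check that the
bound 1/6 is attained for the three given ones. The latter is an explicit point
together with a finite case analysis (D_third, tight_A, tight_B, tight_C). The
former rests on the one-dimensional problem, the lonely runner problem.

Merging two slopes. Order the columns by slope, with positive first coordinates,
and consider the line of the plane on which the sum of two columns at adjacent
slopes vanishes. No column vanishes on it, since none has the mediant slope, and
the two chosen columns are opposite there. So n+1 columns restrict to n speeds, and a plane is at least as lonely as n runners
(lonely_in_plane). With six columns a time at which the resulting five speeds
are further than 1/6 from the integers is excluded; hence these speeds form an
extremal vector for five runners (adjacent_tight).

Five runners. The extremal vectors are, up to scaling and signs, (1,2,3,4,5) and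
(1,3,4,5,9) (lonely_or_tight5). The proof goes by induction on the number of
runners. For n+1 integer speeds, let T be a time at which every runner is within
2/((n+1)(n+2)) of an integer. Together with the speeds the errors span a plane,
lonely to the level 1/(n+1) by the case of n runners; moving to an integer
multiple of T costs less than 1/(n+1) - 1/(n+2). So there is a time with all
distances above 1/(n+2), unless the errors are proportional to the speeds
(near_period). If the largest speed is big, such a T exists by the pigeonhole
principle, and the proportional case replaces the speeds by a smaller
proportional vector. If it is bounded, some prime p of a fixed list divides no
speed (prime_avoid), and a search for coverings of the residues modulo p shows
that some j/p is lonely or has the residues of an extremal vector; the latter is
again a time T as above, and proportionality then means that the speeds are that
extremal vector (tight_or_lonely).

Six columns. Merging the two lowest slopes gives coordinates in which the first
row is an extremal vector with one repeated entry, which sits on both extreme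
slopes (exists_normal_chart). If there are only these two slopes, the plane is a
product: four columns or fewer on a line can be moved to the level 1/5, so one
line carries five columns forming an extremal vector, and the plane is one of
the first two (two_slopes). Otherwise a second merging makes the second row an
extremal vector too. Finitely many configurations remain; all but two have a
lonely point with denominator at most 11, and those two are the third plane in
other coordinates (three_slopes). *)

(** * Searching for covers of the residues modulo a prime *)

(** Masks are lists of booleans without trailing false entries: the empty
    mask is then recognised by its constructor, and a scan of a nearly
    exhausted mask is short. *)
Definition cons_trim (b : bool) (s : seq bool) : seq bool :=
  if b then true :: s else if s is [::] then [::] else false :: s.

Fixpoint mask_and (a b : seq bool) : seq bool :=
  match a, b with
  | x :: a', y :: b' => cons_trim (x && y) (mask_and a' b')
  | _, _ => [::]
  end.

Fixpoint mask_diff (a b : seq bool) : seq bool :=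
  match a, b with
  | x :: a', y :: b' => cons_trim (x && ~~ y) (mask_diff a' b')
  | _, _ => a
  end.

(** A runner that has to cover alone all the times left in U lies in the
    intersection of their rows, since by symmetry row j is also the set of
    the runners close to an integer at time j. This replaces one level of the
    search, the most expensive one. *)
Fixpoint common_cover (U : seq bool) (rows : seq (seq bool)) (acc : seq bool) :=
  match acc, U, rows with
  | [::], _, _ => [::]
  | _, u :: U', r :: rows' => common_cover U' rows' (if u then mask_and acc r else acc)
  | _, _, _ => acc
  end.

Fixpoint first_row (U : seq bool) (rows : seq (seq bool)) :=
  match U, rows with
  | true :: _, r :: _ => r
  | false :: U', _ :: rows' => first_row U' rows'
  | _, _ => [::]
  end.

Section Search.
Variables (rows : seq (seq bool)) (final : seq nat -> bool).

Section Loop.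
Variable visit : seq bool -> seq bool -> nat -> bool.

(** Candidates are tried in increasing order, and each is struck off the
    allowed runners before the next one is tried: a family containing it has
    been treated already, so that each set of runners is met in one order
    only. *)
Fixpoint try_all (c : seq bool) (rs : seq (seq bool)) (v : nat) (al : seq bool) :=
  match c, rs with
  | b :: c', r :: rs' =>
      if b then
        if visit al r v then try_all c' rs' v.+1 (mask_diff al (ncons v false [:: true]))
        else false
      else try_all c' rs' v.+1 al
  | _, _ => true
  end.
End Loop.

(** If k runners of the mask al cover all the times of U, one of them covers
    the first such time, which leaves few candidates to branch on. The search
    succeeds when each family met at depth k either leaves a time uncovered
    or satisfies the final test. *)
Fixpoint cover_search (k : nat) (U al : seq bool) (ch : seq nat) : bool :=
  match k with
  | 0 => has id U || final ch
  | k'.+1 =>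
     has id U &&
     let c := if k' is 0 then common_cover U rows al else mask_and (first_row U rows) al in
     try_all (fun al' r v => cover_search k' (mask_diff U r) al' (v :: ch)) c rows 0 al
  end.

Local Notation "s `_ i" := (nth false s i).

Lemma nth_cons_trim b s i : (cons_trim b s)`_i = (b :: s)`_i.
Proof. by case: b s => [|] [|? ?] //=; case: i => //= i; rewrite nth_nil. Qed.

Lemma nth_mask_and a b i : (mask_and a b)`_i = a`_i && b`_i.
Proof.
elim: a b i => [|x a IH] [|y b] i; rewrite ?nth_nil ?andbF //=.
by rewrite nth_cons_trim; case: i => //=.
Qed.

Lemma nth_mask_diff a b i : (mask_diff a b)`_i = a`_i && ~~ b`_i.
Proof.
elim: a b i => [|x a IH] [|y b] i; rewrite ?nth_nil ?andbT //=.
by rewrite nth_cons_trim; case: i => //=.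
Qed.

Lemma common_cover_mem U rs acc v : acc`_v -> size U <= size rs ->
  (forall j, U`_j -> (nth [::] rs j)`_v) -> (common_cover U rs acc)`_v.
Proof.
elim: U rs acc => [|u U IH] [|r rs] [|x acc] //; rewrite ?nth_nil // => av /= s h.
apply: IH => // [|j]; last exact: (h j.+1).
by case: u h => // /(_ 0 isT) /= rv; rewrite (nth_mask_and (x :: acc)) av.
Qed.

Lemma first_rowP U rs : has id U -> size U <= size rs ->
  exists2 j, U`_j & first_row U rs = nth [::] rs j.
Proof.
elim: U rs => //= u U IH [|r rs] //; case: u => /= [_ _|hU s]; first by exists 0.
by have [j Uj ->] := IH rs hU s; exists j.+1.
Qed.

(** Applied to the smallest candidate y of Y: only smaller candidates, none
    of them in Y, have been struck off when y is visited, hence Y stays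
    allowed. *)
Lemma try_allP visit c rs v al (Y : seq nat) : try_all visit c rs v al ->
  (exists y, [/\ y \in Y, v <= y, y - v < size rs & c`_(y - v)]) ->
  exists y, [/\ y \in Y, v <= y, c`_(y - v) &
    exists2 al', visit al' (nth [::] rs (y - v)) y &
    forall z, z \in Y -> al`_z -> al'`_z].
Proof.
elim: c rs v al => [|b c IH] [|r rs] v al //=.
- by move=> _ [y [_ _ _]]; rewrite nth_nil.
- by move=> _ [y [_ _ _]]; rewrite nth_nil.
- by move=> _ [y [_ _]]; rewrite ltn0.
(* The induction step is the same whether v is no candidate or has been
   visited without belonging to Y; then v is struck off. *)
have step b' al2 : (v \in Y -> b' = false) -> (forall z, z \in Y -> al`_z -> al2`_z) ->
    try_all visit c rs v.+1 al2 ->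
    (exists y, [/\ y \in Y, v <= y, y - v < (size rs).+1 & (b' :: c)`_(y - v)]) ->
    exists y, [/\ y \in Y, v <= y, (b :: c)`_(y - v) &
      exists2 al', visit al' (nth [::] (r :: rs) (y - v)) y &
      forall z, z \in Y -> al`_z -> al'`_z].
  move=> vb hal hl [y [yY vy ys cy]].
  have vy1 : v < y.
    by rewrite ltn_neqAle vy andbT; apply: contraTneq cy => e; rewrite -e subnn /= vb // e.
  have [|y' [y'Y vy' cy' [al' h1 h2]]] := IH rs v.+1 al2 hl.
    by exists y; rewrite vy1 yY; split=> //; move: ys cy; rewrite -[y - v]prednK ?subn_gt0 // -subnS.
  have e : y' - v = (y' - v.+1).+1 by rewrite subnS prednK // subn_gt0.
  exists y'; rewrite e /=; split=> //; first exact: ltnW.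
  by exists al' => // z zY /hal h; apply: h2 => //; apply: h.
case: b step => step.
  case: ifP => // hv hl; have [vY _|vY] := boolP (v \in Y).
    by exists v; rewrite subnn; split=> //; exists al.
  apply: (step true) hl => // [/(negP vY) //|z zY az].
  rewrite nth_mask_diff az nth_ncons /=; case: ltnP => //= vz.
  have : z - v != 0 by rewrite subn_eq0 -ltnNge ltn_neqAle vz andbT; apply: contraNneq vY => ->.
  by case: (z - v) => // -[].
by apply: (step false).
Qed.

Hypothesis rows_sym : forall i j, (nth [::] rows i)`_j = (nth [::] rows j)`_i.

(** A family Y covering U contains a runner that the search visits. Removing
    the smallest such runner from Y gives a family covering the rest of U. *)
Lemma cover_searchP k U al ch : size U <= size rows -> cover_search k U al ch ->
  forall Y, size Y = k -> (forall y, y \in Y -> y < size rows /\ al`_y) ->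
  (exists2 j, U`_j & forall y, y \in Y -> ~~ (nth [::] rows y)`_j) \/
  exists2 Z, perm_eq Z (Y ++ ch) & final Z.
Proof.
elim: k U al ch => [|k IH] U al ch sU.
  move=> h [] // _ _; case/orP: h => [|fch]; last by right; exists ch.
  by move=> /(has_nthP false)[j _ Uj]; left; exists j.
move=> /= /andP[hU hl] Y sY hY.
have [/existsP[j /andP[Uj /allP hj]]|] := boolP [exists j : 'I_(size U), U`_j && all (fun y => ~~ (nth [::] rows y)`_j) Y].
  by left; exists j.
rewrite negb_exists => /forallP ncov.
have cov j : U`_j -> exists2 y, y \in Y & (nth [::] rows y)`_j.
  move=> Uj; have [jU|/(nth_default false) e] := ltnP j (size U); last by rewrite e in Uj.
  have := ncov (Ordinal jU); rewrite /= Uj => /allPn[y yY]; rewrite negbK; by exists y.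
have [y [yY _ _ [al' hv hal]]] : exists y, [/\ y \in Y, 0 <= y,
   (if k is 0 then common_cover U rows al else mask_and (first_row U rows) al)`_(y - 0) &
    exists2 al', cover_search k (mask_diff U (nth [::] rows (y - 0))) al' (y :: ch) &
    forall z, z \in Y -> al`_z -> al'`_z].
  have [y [yY cy]] : exists y, y \in Y /\
     (if k is 0 then common_cover U rows al else mask_and (first_row U rows) al)`_y.
    have [j Uj ej] := first_rowP hU sU.
    have [y yY cy] := cov j Uj; exists y; split=> //.
    have [ys ay] := hY _ yY.
    case: k sY {IH hl} => [|k] sY; last by rewrite nth_mask_and ay ej -rows_sym cy.
    (* With a single runner left in Y it is the same one that covers every
       time. *)
    apply: common_cover_mem => // i Ui; have [y' y'Y] := cov i Ui.
    by case: Y sY yY y'Y {hY ncov cov cy} => // y0 [|//] _; rewrite !inE => /eqP-> /eqP->; rewrite rows_sym.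
  have := try_allP hl; apply; exists y; rewrite subn0; split=> //.
  by have [] := hY _ yY.
rewrite subn0 in hv.
have sU' : size (mask_diff U (nth [::] rows y)) <= size rows.
  apply: leq_trans sU; elim: (U) (nth _ _ _) => //= u U' IHU [|b s] //=.
  by rewrite /cons_trim; case: (u && ~~ b) => /=; [exact: IHU|case: mask_diff (IHU s)].
have [||[j]|[Z pZ fZ]] := IH _ _ _ sU' hv (rem y Y).
- by rewrite size_rem // sY.
- by move=> z /mem_rem zY; have [? ?] := hY _ zY; split=> //; apply: hal.
- rewrite nth_mask_diff => /andP[Uj nj] hj; left; exists j => // z zY.
  have := perm_mem (perm_to_rem yY) z; rewrite zY inE => /esym/orP[/eqP->//|]; exact: hj.
- right; exists Z => //; apply: (perm_trans pZ).
  rewrite -[y :: ch]/([:: y] ++ ch) perm_catCA perm_sym.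
  exact: (perm_cat (perm_to_rem yY) (perm_refl ch)).
Qed.
End Search.

Definition add_mod (p v r : nat) := let s := v + r in if s < p then s else s - p.

(** Distance from r to the nearest multiple of p, for r below p. *)
Definition fold_mod (p r : nat) := minn r (p - r).
Definition cover_row (n p h v : nat) : seq bool :=
  [seq n * fold_mod p r <= p | r <- traject (add_mod p v) v h].

(** Times and runners are both numbered from 0, index i standing for the
    residue i+1; up to sign the residues prime to p are 1, ..., p./2. *)
Definition cover_rows (n p h : nat) := [seq cover_row n p h v | v <- iota 1 h].

(** One of the speeds is 1, so a multiplier taking the speeds to the entries
    of T must be, up to sign, an entry of T. *)
Definition reaches_tight p (TT : seq (seq nat)) ch :=
  has (fun T => has (fun j => perm_eq [seq fold_mod p ((j * v.+1) %% p) | v <- ch] T) T) TT.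

(** Multiplying all the speeds by an inverse of one of them, that one becomes
    1; it is the initial content of the family, and the times it covers are
    removed beforehand. *)
Definition cover_check n p TT :=
  let h := p./2 in let rs := cover_rows n.+1 p h in
  cover_search rs (reaches_tight p TT) n.-1 (mask_diff (nseq h true) (head [::] rs)) (nseq h true) [:: 0].

Lemma iter_add_mod p v i : v < p -> iter i (add_mod p v) v = (i.+1 * v) %% p.
Proof.
move=> vp; elim: i => [|i IH]; first by rewrite mul1n modn_small.
rewrite iterS IH [i.+2 * v]mulSn -modnDmr.
have := ltn_pmod (i.+1 * v) (leq_ltn_trans (leq0n v) vp).
move: ((i.+1 * v) %% p) => r rp; rewrite /add_mod.
case: ltnP => h; first by rewrite modn_small.
by rewrite -[in RHS](subnK h) modnDr modn_small //; lia.
Qed.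

Lemma nth_cover_rows n p i j : odd p -> nth false (nth [::] (cover_rows n p p./2) i) j =
  [&& i < p./2, j < p./2 & n * fold_mod p ((j.+1 * i.+1) %% p) <= p].
Proof.
move=> op; have [ih|ih] := ltnP i p./2; last first.
  by rewrite [nth [::] _ _]nth_default ?nth_nil // size_map size_iota.
rewrite [nth [::] _ _](nth_map 0) ?size_iota // nth_iota // add1n.
have [jh|jh] := ltnP j p./2; last by rewrite nth_default // size_map size_traject.
by rewrite (nth_map i.+1) ?size_traject // nth_traject // iter_add_mod //; lia.
Qed.

Lemma cover_checkP n p TT : odd p -> 1 < p -> cover_check n p TT ->
  forall Y, size Y = n.-1 -> (forall y, y \in Y -> y < p./2) ->
  (exists2 j, p < n.+1 * fold_mod p (j.+1 %% p) &
    forall y, y \in Y -> p < n.+1 * fold_mod p ((j.+1 * y.+1) %% p)) \/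
  exists2 Z, perm_eq Z (Y ++ [:: 0]) & reaches_tight p TT Z.
Proof.
move=> op p1 hc Y sY hY.
have h0 : 0 < p./2 by lia.
have [||y yY|[j]|] := cover_searchP _ _ hc sY; last by right.
- move=> i j; rewrite !nth_cover_rows // [X in X %% _]mulnC.
  by case: (i < _); case: (j < _).
- rewrite /cover_rows size_map size_iota; apply: (@leq_trans (size (nseq p./2 true))).
    elim: (nseq _ _) (head _ _) => //= u U IHU [|b s] //=.
    by rewrite /cons_trim; case: (u && ~~ b) => /=; [exact: IHU|case: mask_diff (IHU s)].
  by rewrite size_nseq.
- by rewrite size_map size_iota nth_nseq; have -> := hY _ yY.
rewrite nth_mask_diff nth_nseq -nth0 nth_cover_rows // h0 muln1 /=.
case: ltnP => //= jh nj hj; left; exists j; first by rewrite ltnNge.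
move=> y yY; have := hj _ yY; rewrite nth_cover_rows // jh (hY _ yY) /=.
by rewrite ltnNge.
Qed.

(** * A prime dividing none of the speeds *)

Lemma prod_primes_dvd (F : seq nat) m : uniq F -> (forall p, p \in F -> prime p /\ p %| m) ->
  \prod_(p <- F) p %| m.
Proof.
elim: F => [|p F IH] /=; first by rewrite big_nil dvd1n.
move=> /andP[pF uF] h; rewrite big_cons Gauss_dvd.
  rewrite (h p _).2 ?mem_head //= IH // => q qF; apply: h; by rewrite inE qF orbT.
have [|pp _] := h p; first exact: mem_head.
rewrite big_seq; apply: (big_ind (coprime p)) => [|x y|q qF]; first exact: coprimen1.
  by rewrite coprimeMr => -> ->.
have [|qp _] := h q; first by rewrite inE qF orbT.
by rewrite prime_coprime // dvdn_prime2 //; apply: contraNneq pF => ->.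
Qed.

(** A nonzero integer of absolute value at most B has at most c divisors
    among primes that are at least b, because a product of c+1 of them
    exceeds B. All the speeds together thus rule out at most size s * c
    primes. *)
Lemma prime_avoid (L : seq nat) (s : seq int) b B c : uniq L ->
  (forall p, p \in L -> prime p /\ b <= p) -> B < b ^ c.+1 ->
  (forall v, v \in s -> v != 0%R /\ `|v|%N <= B) -> size s * c < size L ->
  exists2 p, p \in L & forall v, v \in s -> ~~ (p %| v)%Z.
Proof.
move=> uL hL hB hs hsz.
have few v : v \in s -> count (fun p => p %| `|v|) L <= c.
  move=> /hs[v0 vB]; rewrite leqNgt; apply/negP => hc.
  pose F := [seq p <- L | p %| `|v|].
  have hF p : p \in F -> prime p /\ p %| `|v|.
    by rewrite mem_filter => /andP[pv /hL[]].
  have /dvdn_leq : \prod_(p <- F) p %| `|v| by apply: prod_primes_dvd => //; apply: filter_uniq.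
  rewrite absz_gt0 v0 => /(_ isT) hv.
  have hb : b ^ size F <= \prod_(p <- F) p.
    have : forall p, p \in F -> b <= p by move=> p; rewrite mem_filter => /andP[_ /hL[]].
    elim: (F) => [|p F' IH] h; first by rewrite big_nil.
    rewrite big_cons expnS leq_mul ?h ?mem_head // IH // => q qF; apply: h; by rewrite inE qF orbT.
  have b0 : 0 < b by case: (b) hB => //; rewrite exp0n.
  have : b ^ c.+1 <= b ^ size F by rewrite leq_pexp2l // size_filter.
  move=> h1; have := leq_trans (leq_trans h1 hb) hv; have [_ _] := (v0, vB).
  by move=> h2; have := leq_trans hB (leq_trans h2 vB); rewrite ltnn.
pose av s := count (fun p => all (fun v => ~~ (p %| `|v|)) s) L.
have : size L <= av s + size s * c.
  elim: (s) few => [|v s' IH] few; first by rewrite /av (eq_count (a2 := predT)) // count_predT leq_addr.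
  have h1 := few v (mem_head _ _).
  have h2 : av s' <= av (v :: s') + count (fun p => p %| `|v|) L.
    rewrite /av -count_predUI; apply: leq_trans (leq_addr _ _).
    by apply: sub_count => p /= ->; case: (p %| _).
  have h3 := IH (fun w ws => few w (mem_behead (s := v :: s') ws)).
  rewrite /= mulSn; move: h1 h2 h3; move: (av _) (av _) (count _ _) (size L) => x y z t; lia.
move=> h; have /hasP[p pL /allP hp] : has (fun p => all (fun v => ~~ (p %| `|v|)) s) L.
  by rewrite has_count -/(av s); lia.
by exists p => // v /hp; rewrite dvdzE absz_nat.
Qed.

Local Open Scope ring_scope.

(** * Loneliness on lines and the passage from lines to planes *)

(** The stationary runner is at 0: far k x says that x is at distance at
    least k from the integers. All of the combinatorics takes place over the
    rationals, where the speeds and the extremal times live. *)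
Definition far (k x : rat) : Prop := forall m : int, k <= `|x - m%:~R|.
Definition strictly_far (k x : rat) : Prop := forall m : int, k < `|x - m%:~R|.

Lemma norm_sub_oppz (x : rat) (m : int) : `|- x - m%:~R| = `|x - (- m)%:~R|.
Proof. by rewrite mulrNz opprK -opprD normrN. Qed.

Lemma far_opp k x : far k x -> far k (- x).
Proof. by move=> h m; rewrite norm_sub_oppz. Qed.

Lemma far_norm k x y : `|x| = `|y| -> far k x -> far k y.
Proof.
move=> /eqP; rewrite eqr_norm2 => /orP[/eqP-> //|/eqP->] /far_opp.
by rewrite opprK.
Qed.

Lemma strictly_far_opp k x : strictly_far k x -> strictly_far k (- x).
Proof. by move=> h m; rewrite norm_sub_oppz. Qed.

Lemma far_perturb k x y (n : int) : far k x -> forall e, `|x - y + n%:~R| < e -> strictly_far (k - e) y.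
Proof.
move=> h e xy m; have := h (m - n); rewrite intrB => hm.
have := ler_normB (x - y + n%:~R) (x - (m%:~R - n%:~R)).
have -> : x - y + n%:~R - (x - (m%:~R - n%:~R)) = - (y - m%:~R) by ring.
rewrite normrN => h2.
have := lerB_dist (x - (m%:~R - n%:~R)) (x - y + n%:~R).
have -> : (x - (m%:~R - n%:~R)) - (x - y + n%:~R) = (y - m%:~R) by ring.
lra.
Qed.

Lemma far_of_strictly_far k x : strictly_far k x -> far k x.
Proof. by move=> h m; apply: ltW. Qed.

Definition lonely_runner n := forall s : seq rat, size s = n -> (forall x, x \in s -> x != 0) ->
  exists t : rat, forall x, x \in s -> far (n.+1%:R^-1) (t * x).

(** Beyond 0 and 1 every other integer is further away from a point of the
    unit interval. *)
Lemma middle_far (m : int) (a x : rat) : 0 <= a -> a <= x -> x <= 1 - a -> a <= `|x - m%:~R|.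
Proof.
move=> a0 ax xa; have [m0|m1] := lerP m 0.
  have : (m%:~R : rat) <= 0 by rewrite lerz0.
  by move=> hm; rewrite ger0_norm; lra.
have : (1 : rat) <= m%:~R by rewrite (ler_int _ 1).
by move=> hm; rewrite ler0_norm; lra.
Qed.

Lemma lonely_runner1 : lonely_runner 1.
Proof.
case=> [//|x []] // _ h; have x0 : x != 0 by apply: h; rewrite mem_head.
exists (2^-1 / x) => y; rewrite inE => /eqP-> m; rewrite divfK //.
by apply: middle_far; lra.
Qed.

Lemma ex_argmin (T : eqType) (f : T -> rat) (s : seq T) :
  s != [::] -> exists2 i, i \in s & forall j, j \in s -> f i <= f j.
Proof.
elim: s => // x s IH _; case: s IH => [_|y s /(_ isT) [i is_ hi]].
  by exists x; rewrite ?mem_head // => j; rewrite inE => /eqP->.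
have [xi|ix] := lerP (f x) (f i).
  exists x; rewrite ?mem_head // => j; rewrite inE => /orP[/eqP-> //|/hi].
  exact: le_trans.
exists i; first by rewrite inE is_ orbT.
by move=> j; rewrite inE => /orP[/eqP->|/hi //]; apply: ltW.
Qed.

Definition slope (c : rat * rat) := c.2 / c.1.

Lemma adjacent_slopes (L : seq (rat * rat)) :
  (exists c d, [/\ c \in L, d \in L & slope c != slope d]) ->
  exists i j, [/\ i \in L, j \in L, slope i < slope j &
    forall c, c \in L -> slope c = slope i \/ slope j <= slope c].
Proof.
move=> [c [d [cL dL cd]]].
have Ln : L != [::] by case: (L) cL.
have [i iL hi] := ex_argmin slope Ln.
pose L' := [seq c <- L | slope i < slope c].
have /ex_argmin : L' != [::].
  suff [e eL ie] : exists2 e, e \in L & slope i < slope e.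
    have : e \in L' by rewrite mem_filter ie.
    by case: (L').
  have [ci|ci] := eqVneq (slope c) (slope i).
    by exists d => //; rewrite lt_neqAle hi // andbT -ci.
  by exists c => //; rewrite lt_neqAle hi // andbT eq_sym.
move=> /(_ slope)[j]; rewrite mem_filter => /andP[ij jL] hj.
exists i, j; split=> // e eL.
have [->|ei] := eqVneq (slope e) (slope i); first by left.
by right; apply: hj; rewrite mem_filter eL andbT lt_neqAle eq_sym ei hi.
Qed.

(** Slope of the sum i + j. A form vanishing on i + j takes opposite values
    on i and j, so that one of the two stands for both. *)
Definition mediant (i j : rat * rat) := (i.2 + j.2) / (i.1 + j.1).
Definition mediant_form (i j c : rat * rat) := c.2 - mediant i j * c.1.

Lemma mediant_formE i j c : c.1 != 0 -> mediant_form i j c = c.1 * (slope c - mediant i j).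
Proof. by move=> c0; rewrite /mediant_form /slope mulrBr [c.1 * (_ / _)]mulrC divfK // [c.1 * mediant _ _]mulrC. Qed.

Lemma mediant_form_opp i j : 0 < i.1 -> 0 < j.1 -> mediant_form i j i = - mediant_form i j j.
Proof. by case: i j => [a b] [c d] /= ha hc; rewrite /mediant_form /mediant /=; field; lra. Qed.

Lemma mediant_between i j : 0 < i.1 -> 0 < j.1 -> slope i < slope j ->
  slope i < mediant i j < slope j.
Proof.
case: i j => [a b] [c d] /= ha hc; rewrite /slope /mediant /= => h.
have ac : 0 < a + c by lra.
have h2 : b * c < d * a by rewrite ltr_pdivrMr // mulrAC ltr_pdivlMr // in h.
by rewrite ltr_pdivrMr // ltr_pdivlMr // ![_ / _ * _]mulrAC ltr_pdivlMr // ltr_pdivrMr //; lra.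
Qed.

(** Replaces a column by its opposite so that the first coordinate becomes
    positive; this changes neither the slope nor the distances to the
    integers. *)
Definition flip (c : rat * rat) : rat * rat := if c.1 < 0 then (- c.1, - c.2) else c.

Lemma flip_gt0 c : c.1 != 0 -> 0 < (flip c).1.
Proof.
rewrite /flip => c0; case: ifP => [h|/negbT]; first by rewrite oppr_gt0.
by rewrite -leNgt le_eqVlt eq_sym (negPf c0).
Qed.

Lemma slope_flip c : slope (flip c) = slope c.
Proof. by rewrite /flip /slope; case: ifP => //= _; rewrite invrN mulrNN. Qed.

Lemma flip_form a b c : `|a * (flip c).1 + b * (flip c).2| = `|a * c.1 + b * c.2|.
Proof. by rewrite /flip; case: ifP => //= _; rewrite !mulrN -opprD normrN. Qed.

(** Consider the line of the plane on which the sum of two columns at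
    adjacent slopes vanishes. No column vanishes there, since none has the
    mediant slope, and the two columns run at opposite speeds. So n+1 runners
    in the plane reduce to n runners on that line, and the bound is that of n
    runners. *)
Lemma lonely_in_plane n (L : seq (rat * rat)) : lonely_runner n -> size L = n.+1 ->
  (forall c, c \in L -> c.1 != 0) ->
  (exists c d, [/\ c \in L, d \in L & slope c != slope d]) ->
  exists a b, forall c, c \in L -> far (n.+1%:R^-1) (a * c.1 + b * c.2).
Proof.
move=> lr sL L0 [c [d [cL dL cd]]].
pose L' := [seq flip c | c <- L].
have L'0 c' : c' \in L' -> 0 < c'.1 by move=> /mapP[e eL ->]; apply/flip_gt0/L0.
have [|i [j [iL jL ij adj]]] := @adjacent_slopes L'.
  by exists (flip c), (flip d); rewrite !slope_flip !map_f.
have [h1 h2] := andP (mediant_between (L'0 _ iL) (L'0 _ jL) ij).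
have w0 e : e \in L' -> mediant_form i j e != 0.
  move=> eL; have e0 := lt0r_neq0 (L'0 _ eL).
  rewrite mediant_formE // mulf_neq0 // subr_eq0.
  by case: (adj _ eL) => [->|je]; [rewrite lt_eqF | rewrite gt_eqF // (lt_le_trans h2)].
pose s := [seq mediant_form i j e | e <- rem j L'].
have [||t ht] := lr s.
- by rewrite size_map size_rem // size_map sL.
- by move=> x /mapP[e /mem_rem eL ->]; apply: w0.
have ij' : i \in rem j L'.
  have := perm_mem (perm_to_rem jL) i; rewrite iL inE => /esym/orP[/eqP e|//].
  by rewrite e ltxx in ij.
exists (- t * mediant i j), t => e eL.
have fe : forall f, f \in L' -> far (n.+1%:R^-1) (t * mediant_form i j f).
  move=> f fL; have := perm_mem (perm_to_rem jL) f; rewrite fL inE => /esym/orP[/eqP->|fr].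
    rewrite -[mediant_form i j j]opprK -mediant_form_opp ?L'0 // mulrN; apply: far_opp.
    by apply: ht; apply: map_f.
  by apply: ht; apply: map_f.
apply: (far_norm (flip_form _ _ _)).
have := fe _ (map_f flip eL); congr far; rewrite /mediant_form; ring.
Qed.

(** * Near-periods *)

Definition strictly_lonely n (s : seq int) := exists t : rat, forall v, v \in s -> strictly_far (n.+1%:R^-1) (t * v%:~R).

Lemma inv_gap n : (n.+2%:R : rat)^-1 = n.+1%:R^-1 - (n.+1%:R * n.+2%:R)^-1.
Proof.
have n0 : (0 : rat) <= n%:R by [].
have -> : n.+2%:R = n%:R + 2 :> rat by rewrite -natrD addn2.
have -> : n.+1%:R = n%:R + 1 :> rat by rewrite -natr1.
by field; apply/andP; split; apply/lt0r_neq0; lra.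
Qed.

(** Put d v = T v - m v. At time a + k T with k an integer, the runner v is
    at a v + k (d v) modulo 1, so these times trace the integer lines of the
    plane of columns (v, d v). That plane has a point (a, b) at distance at
    least 1/(n+1) from the integers in each coordinate; rounding b to k costs
    less than (1/2) * 2 / ((n+1)(n+2)), which is the gap between 1/(n+1) and
    1/(n+2). The argument fails when all the columns (v, d v) are parallel. *)
Lemma near_period n (s : seq int) (T : rat) (m : int -> int) :
  lonely_runner n -> size s = n.+1 -> (forall v, v \in s -> v != 0) ->
  (forall v, v \in s -> `|T * v%:~R - (m v)%:~R| < 2 / (n.+1%:R * n.+2%:R)) ->
  strictly_lonely n.+1 s \/ exists c, forall v, v \in s -> T * v%:~R - (m v)%:~R = c * v%:~R.
Proof.
move=> lr ss s0 hT.
pose it v : rat * rat := (v%:~R, T * v%:~R - (m v)%:~R).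
case: s ss s0 hT => // v0 s' ss s0 hT; set s := v0 :: s' in ss s0 hT *.
have [/allP h|/allPn[v vs hv]] := boolP (all (fun v => slope (it v) == slope (it v0)) s).
  right; exists (slope (it v0)) => v vs; have /eqP <- := h _ vs.
  by rewrite /slope /= divfK // intr_eq0 s0.
left.
have [|c /mapP[w ws ->]||a [b hab]] := @lonely_in_plane n [seq it v | v <- s] lr.
- by rewrite size_map.
- by rewrite intr_eq0 s0.
- by exists (it v), (it v0); rewrite !map_f // mem_head.
pose k := Num.floor (b + 2^-1).
have /andP[k1 k2] : k%:~R <= b + 2^-1 < (k + 1)%:~R by rewrite Num.Theory.floor_le Num.Theory.floorD1_gt.
rewrite intrD in k2.
have bk : `|b - k%:~R| <= 2^-1 by rewrite ler_norml; apply/andP; split; lra.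
exists (a + k%:~R * T) => w ws.
have hw := hT _ ws.
set e : rat := (n.+1%:R * n.+2%:R)^-1.
rewrite (inv_gap n) -/e.
apply: (far_perturb (n := k * m w) (hab _ (map_f it ws))) => /=.
have -> : a * w%:~R + b * (T * w%:~R - (m w)%:~R) - (a + k%:~R * T) * w%:~R + (k * m w)%:~R
  = (b - k%:~R) * (T * w%:~R - (m w)%:~R) by rewrite intrM; ring.
rewrite normrM; move: hw; rewrite -/e; set d := `|T * _ - _| => hw.
have d0 : 0 <= d by apply: normr_ge0.
have : `|b - k%:~R| * d <= 2^-1 * d by apply: ler_wpM2r.
by lra.
Qed.

(** Simultaneous approximation by the pigeonhole principle: the e points (k v
    / e) modulo 1 fall into M ^ size s boxes. The strict inequality M ^ size
    s < e gives two of them in a single box. *)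
Lemma dirichlet (M e : nat) (s : seq int) : (0 < M)%N -> (M ^ size s < e)%N ->
  exists k : nat, (0 < k < e)%N /\ exists m : int -> int,
    forall v, v \in s -> `|k%:R * v%:~R - e%:R * (m v)%:~R| * M%:R < e%:R :> rat.
Proof.
move=> M0 Me; have e0 : (0 < e)%N by apply: leq_ltn_trans Me.
have ez : (e : int) != 0 by lia.
pose r (k : nat) v := ((k%:Z * v) %% e)%Z.
pose q (k : nat) v := ((k%:Z * v) %/ e)%Z.
pose b (k : nat) v := ((r k v * M) %/ e)%Z.
have r0 k v : 0 <= r k v by rewrite modz_ge0.
have re k v : r k v < e by apply: ltz_pmod.
have bE k v : b k v * e <= r k v * M < b k v * e + e.
  rewrite /b [X in _ <= X](divz_eq (r k v * M) e) [X in X < _](divz_eq (r k v * M) e).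
  by rewrite lerDl modz_ge0 // ltrD2l ltz_pmod.
have b0 k v : 0 <= b k v by have := bE k v; have := r0 k v; nia.
have bM k v : (`|b k v| < M)%N by have := bE k v; have := b0 k v; have := re k v; nia.
pose f (k : 'I_e) : {ffun 'I_(size s) -> 'I_M} := [ffun i : 'I__ => Ordinal (bM k s`_i)].
have /injectivePn[k [k' kk' fk]] : ~~ injectiveb f.
  apply/injectiveP => /leq_card; rewrite card_ffun !card_ord => h.
  by move: (leq_ltn_trans h Me); rewrite ltnn.
(* The box of k is that of k'; their difference is the required multiplier. *)
wlog kltk' : k k' kk' fk / (k < k')%N.
  move=> H; have [|h|/val_inj h] := ltngtP k k'; first exact: H.
    by apply: (H k' k) => //; rewrite eq_sym.
  by rewrite h eqxx in kk'.
exists (k' - k)%N; split; first by have := ltn_ord k'; lia.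
exists (fun v => q k' v - q k v) => v vs.
have bv : b k v = b k' v.
  have := congr1 (fun g : {ffun _ -> _} => val (g (Ordinal (n := size s) (m := index v s) _))) fk.
  move=> /(_ ltac:(by rewrite index_mem)); rewrite !ffunE /= nth_index //.
  by have := b0 k v; have := b0 k' v; lia.
have kv := divz_eq (k%:Z * v) e; have k'v := divz_eq (k'%:Z * v) e.
have h1 := bE k v; have h2 := bE k' v; rewrite bv in h1.
have E : (k' - k)%N%:Z * v - e%:Z * (q k' v - q k v) = r k' v - r k v.
  by rewrite -subzn 1?ltnW //; move: kv k'v; rewrite -/(r _ _) -/(r _ _) -/(q _ _) -/(q _ _); nia.
have E' : (k' - k)%N%:R * v%:~R - e%:R * (q k' v - q k v)%:~R = (r k' v - r k v)%:~R :> rat.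
  by rewrite -E [RHS]intrB !intrM.
rewrite E' -[M%:R]/((M : int)%:~R) -[e%:R]/((e : int)%:~R) -intr_norm -intrM ltr_int.
by lia.
Qed.

(** * Distance to the multiples of a prime *)

Definition dist_mod (p : nat) (z : int) : nat := fold_mod p `|(z %% p)%Z|%N.

Lemma dist_mod_nat p (k : nat) : dist_mod p k = fold_mod p (k %% p).
Proof. by rewrite /dist_mod modz_nat. Qed.

Lemma dist_mod_eq p (z w : int) : (0 < p)%N -> (p %| z - w)%Z \/ (p %| z + w)%Z -> dist_mod p z = dist_mod p w.
Proof.
move=> p0; have pz : (p : int) != 0 by lia.
have hz := divz_eq z p; have hw := divz_eq w p.
have z0 := modz_ge0 z pz; have w0 := modz_ge0 w pz.
have zp : (z %% p)%Z < p by apply: ltz_pmod.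
have wp : (w %% p)%Z < p by apply: ltz_pmod.
rewrite /dist_mod /fold_mod; move: hz hw z0 w0 zp wp.
move: (z %% p)%Z (w %% p)%Z (z %/ p)%Z (w %/ p)%Z => r s q q' -> -> r0 s0 rp sp.
case=> /dvdzP[k].
  move=> e; have : r - s = (k - q + q') * p by lia.
  move: (k - q + q') => t h; have t0 : t = 0 by clear -h r0 s0 rp sp; nia.
  by rewrite t0 mul0r in h; congr minn; lia.
move=> e; have : r + s = (k - q - q') * p by lia.
move: (k - q - q') => t h; have : t = 0 \/ t = 1 by clear -h r0 s0 rp sp; nia.
by case=> ht; rewrite ht ?mul0r ?mul1r in h; lia.
Qed.

Definition near_quo (p : nat) (z : int) : int :=
  let r := `|(z %% p)%Z|%N in if (r <= p - r)%N then (z %/ p)%Z else (z %/ p)%Z + 1.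

Lemma dist_mod_near p (z : int) : (0 < p)%N -> `|z - p%:Z * near_quo p z| = dist_mod p z :> int.
Proof.
move=> p0; have pz : (p : int) != 0 by lia.
have hz := divz_eq z p; have z0 := modz_ge0 z pz.
have zp : (z %% p)%Z < p by apply: ltz_pmod.
rewrite /dist_mod /fold_mod /near_quo; move: hz z0 zp; move: (z %% p)%Z (z %/ p)%Z => r q -> r0 rp.
by case: leqP => h; lia.
Qed.

Lemma dist_mod_repr p (z : int) : (0 < p)%N -> exists m : int, `|z - p%:Z * m| = dist_mod p z :> int.
Proof. by move=> p0; exists (near_quo p z); apply: dist_mod_near. Qed.

Lemma dist_mod_min p (z m : int) : (0 < p)%N -> dist_mod p z <= `|z - p%:Z * m| :> int.
Proof.
move=> p0; have pz : (p : int) != 0 by lia.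
have hz := divz_eq z p; have z0 := modz_ge0 z pz.
have zp : (z %% p)%Z < p by apply: ltz_pmod.
rewrite /dist_mod /fold_mod; move: hz z0 zp; move: (z %% p)%Z (z %/ p)%Z => r q -> r0 rp.
have -> : q * p%:Z + r - p%:Z * m = r + (q - m) * p%:Z by lia.
move: (q - m) => t; have [t0|[t0|t0]] : t >= 0 \/ t = -1 \/ t <= -2 by lia.
- by nia.
- by subst t; lia.
- by nia.
Qed.

Lemma dist_mod_mul p (z w : int) : (0 < p)%N -> dist_mod p (z * w) = dist_mod p (z * dist_mod p w).
Proof.
move=> p0; have [m hm] := dist_mod_repr w p0; apply: dist_mod_eq => //.
have [e|e] : w - p%:Z * m = dist_mod p w \/ w - p%:Z * m = - (dist_mod p w)%:Z by lia.
  left; rewrite -e; apply/dvdzP; exists (z * m); ring.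
right; have -> : (dist_mod p w : int) = p%:Z * m - w by lia.
by apply/dvdzP; exists (z * m); ring.
Qed.

(** Multiplication by an inverse u of the first residue and folding by sign
    brings the speeds into the range of the search; the multiplier found
    there is then composed with u. *)
Lemma cover_check_sound n p TT (X : seq int) : prime p -> odd p -> cover_check n.+1 p TT ->
  size X = n.+1 -> (forall x, x \in X -> ~~ (p %| x)%Z) ->
  (exists j : int, forall x, x \in X -> (p < n.+2 * dist_mod p (j * x))%N) \/
  exists (j : int) (T : seq nat), T \in TT /\ perm_eq [seq dist_mod p (j * x) | x <- X] T.
Proof.
move=> pp op hc; case: X => // x1 X [sX] hX.
have p0 := prime_gt0 pp; have p1 := prime_gt1 pp.
have cop x : ~~ (p %| x)%Z -> coprimez p x.
  by rewrite coprimezE dvdzE absz_nat prime_coprime.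
have [u hu] : exists u : int, (p %| u * x1 - 1)%Z.
  have /coprimezP[[a b] /= e] := cop _ (hX _ (mem_head _ _)).
  by exists b; apply/dvdzP; exists (- a); lia.
have ux : (0 < p)%N -> forall x, x \in X -> (0 < dist_mod p (u * x) <= p./2)%N.
  move=> _ x xX; apply/andP; split; last by rewrite /dist_mod /fold_mod; lia.
  rewrite lt0n; apply/eqP => e; have [m] := dist_mod_repr (u * x) p0.
  rewrite e => /eqP; rewrite normr_eq0 subr_eq0 => /eqP ex.
  have : (p %| u * x)%Z by rewrite ex dvdz_mulr.
  have cu : coprimez p u.
    apply: cop; apply/negP => /dvdzP[k ek]; move: hu; rewrite ek => /dvdzP[l el].
    have : (k * x1 - l) * p = 1 by lia.
    by move: (k * x1 - l) => t; nia.
  by rewrite Gauss_dvdzr // => /(negP (hX _ _)); apply; rewrite inE xX orbT.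
pose y (x : int) := (dist_mod p (u * x)).-1.
have yE x : x \in X -> (y x).+1 = dist_mod p (u * x).
  by move=> /(ux p0)/andP[h _]; rewrite prednK.
have amE (k : int) x : x \in X -> dist_mod p (k * (y x).+1) = dist_mod p (k * u * x).
  by move=> xX; rewrite yE // -dist_mod_mul // mulrA.
have am1 (k : int) : dist_mod p (k * u * x1) = dist_mod p k.
  by apply: dist_mod_eq => //; left; rewrite -{2}[k]mulr1 -mulrA -mulrBr dvdz_mull.
have [|z|[j j1 hj]|[Z pZ]] := cover_checkP op p1 hc (Y := [seq y x | x <- X]).
- by rewrite size_map.
- by move=> /mapP[x xX ->]; have := ux p0 _ xX; rewrite /y; lia.
- left; exists (j.+1%:Z * u) => x; rewrite inE => /orP[/eqP->|xX].
    by rewrite am1 dist_mod_nat.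
  by have := hj _ (map_f y xX); rewrite -dist_mod_nat PoszM amE.
move=> /hasP[T TT_T /hasP[j jT hp]]; right; exists (j%:Z * u), T; split=> //.
rewrite /= am1; apply: perm_trans hp.
have -> : [seq fold_mod p ((j * v.+1) %% p) | v <- Z] = [seq dist_mod p (j%:Z * v.+1) | v <- Z].
  by apply: eq_map => v; rewrite -dist_mod_nat PoszM.
have := perm_map (fun v : nat => dist_mod p (j%:Z * v.+1)) pZ.
rewrite map_cat /= mulr1 perm_sym => pe; apply: (perm_trans _ pe).
rewrite perm_sym perm_catC /= perm_cons -map_comp perm_sym.
suff -> : [seq dist_mod p (j%:Z * u * x) | x <- X] = [seq dist_mod p (j%:Z * (y x).+1) | x <- X] by [].
by apply/eq_in_map => x xX; rewrite amE.
Qed.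

(** * Tight and non-tight speeds *)

(** Up to sign, order and scaling, s is one of the vectors of TT. *)
Definition int_tight (TT : seq (seq nat)) (s : seq int) := exists (T : seq nat) (c : rat),
  T \in TT /\ perm_eq [seq `|v%:~R| | v <- s] [seq c * t%:R | t <- T].

Section TightOrLonely.
Variables (n M b c : nat) (TT : seq (seq nat)) (L : seq nat).
Hypothesis lr : lonely_runner n.
Hypothesis M2 : (2 * M = n.+1 * n.+2)%N.
Hypothesis L_uniq : uniq L.
Hypothesis L_ok : forall p, p \in L -> [/\ prime p, odd p, (b <= p)%N & cover_check n.+1 p TT].
Hypothesis T_small : forall T t, T \in TT -> t \in T -> (0 < t)%N /\ (t * M < b)%N.
Hypothesis L_size : (n.+1 * c < size L)%N.
Hypothesis bc : (M ^ n < b ^ c.+1)%N.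

Let eta : 2 / (n.+1%:R * n.+2%:R) = M%:R^-1 :> rat.
Proof.
rewrite -natrM -M2 natrM invfM mulVKf //.
Qed.

(** Induction on the largest speed e. If e exceeds M ^ n, a time k/e with k <
    e is a near-period, and it is an exact period of the fastest runner; so
    near_period either gives a lonely time or makes (k/e) s integral, a
    proportional vector with a smaller largest speed. Otherwise the speeds
    are bounded, and modulo a prime p dividing none of them the search
    applies: if it does not give a lonely time j/p, the residues at time j/p
    are the entries of some T divided by p, and as the entries of T are below
    p / M this is again a near-period, so that s is proportional to T. *)
Lemma tight_or_lonely (s : seq int) : size s = n.+1 -> (forall v, v \in s -> v != 0) ->
  strictly_lonely n.+1 s \/ int_tight TT s.
Proof.
have M0 : (0 < M)%N by case: (M) M2.
have Mr : (0 : rat) < M%:R by rewrite ltr0n.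
have [E] : exists E, forall v, v \in s -> (`|v| <= E)%N.
  by exists (\max_(v <- s) `|v|)%N => v vs; rewrite (leq_bigmax_seq (F := fun v => `|v|%N)).
elim: E s => [|E IH] s sE ss s0.
  case: s sE ss s0 => // v s sE _ s0; have := sE v (mem_head _ _); have := s0 v (mem_head _ _); lia.
have [v0 v0s hv0] : exists2 v0, v0 \in s & forall v, v \in s -> (`|v| <= `|v0|)%N.
  have [|v0 v0s hv0] := @ex_argmin _ (fun v : int => - `|v|%N%:R) s; first by case: (s) ss.
  by exists v0 => // v /hv0; rewrite lerN2 ler_nat.
set e := `|v0|%N in hv0.
have e0 : (0 < e)%N by rewrite absz_gt0 s0.
have er : (0 : rat) < e%:R by rewrite ltr0n.
have [big|small] := ltnP (M ^ n) e.
  have [k [/andP[k0 ke] [m hm]]] : exists k : nat, (0 < k < e)%N /\ exists m : int -> int,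
    forall v, v \in rem v0 s -> `|k%:R * v%:~R - e%:R * (m v)%:~R| * M%:R < e%:R :> rat.
    by apply: dirichlet => //; rewrite size_rem // ss.
  have kr : (0 : rat) < k%:R by rewrite ltr0n.
  (* The fastest runner has an exact period 1/e, so its error is 0 and in the
     proportional case all errors vanish. *)
  pose m' v := if v == v0 then sgz v0 * k else m v.
  have v0E : v0%:~R = (sgz v0)%:~R * e%:R :> rat.
    by rewrite -[e%:R]/((e : int)%:~R) -intrM; congr intmul; rewrite /e; lia.
  have m'0 : k%:R / e%:R * v0%:~R - (m' v0)%:~R = 0 :> rat.
    rewrite /m' eqxx intrM v0E -[(k : int)%:~R]/(k%:R); field; exact: lt0r_neq0.
  have [|?|[c' hc]] := @near_period n s (k%:R / e%:R) m' lr ss s0; last 1 first.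
  - have c0 : c' = 0.
      have := hc _ v0s; rewrite m'0 => /esym/eqP; rewrite mulf_eq0 intr_eq0 (negPf (s0 _ v0s)) orbF.
      by move/eqP.
    have mE v : v \in s -> (m' v)%:~R = k%:R / e%:R * v%:~R :> rat.
      by move=> /hc; rewrite c0 mul0r => /eqP; rewrite subr_eq0 => /eqP.
    have mn v : v \in s -> (e * `|m' v| = k * `|v|)%N.
      move=> /mE h; have : e%:R * (m' v)%:~R = k%:R * v%:~R :> rat.
        by rewrite h; field; exact: lt0r_neq0.
      rewrite -[e%:R]/((e : int)%:~R) -[k%:R]/((k : int)%:~R) -!intrM => /intr_inj; lia.
    have [||v|[t ht]|[T [c1 [TT_T pT]]]] := IH [seq m' v | v <- s].
    + move=> v /mapP[w ws ->]; have := mn _ ws; have := hv0 _ ws; have := sE _ v0s; rewrite -/e; nia.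
    + by rewrite size_map.
    + move=> /mapP[w ws ->]; have := mn _ ws; have := s0 _ ws; nia.
    + left; exists (t * (k%:R / e%:R)) => v vs; rewrite -mulrA -mE //.
      by apply: ht; apply: map_f.
    + right; exists T, (c1 * e%:R / k%:R); split=> //.
      have := perm_map (fun x : rat => x * e%:R / k%:R) pT; rewrite -!map_comp.
      have -> : [seq ((fun x : rat => x * e%:R / k%:R) \o (fun v : int => `|v%:~R|) \o m') v | v <- s] =
                [seq `|v%:~R| : rat | v <- s].
        apply/eq_in_map => v /mE /= ->; rewrite normrM [`|k%:R / _|]gtr0_norm ?divr_gt0 //.
        by field; rewrite !lt0r_neq0.
      move=> h; apply: (perm_trans h); rewrite (eq_map (g := fun t : nat => c1 * e%:R / k%:R * t%:R)) //.
      by move=> t /=; ring.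
  - move=> v vs; rewrite eta; have [->|vv0] := eqVneq v v0; first by rewrite m'0 normr0 invr_gt0.
    rewrite /m' (negPf vv0); have vr : v \in rem v0 s.
      by have := perm_mem (perm_to_rem v0s) v; rewrite vs inE (negPf vv0).
    have := hm _ vr; rewrite -ltr_pdivlMr // => h.
    have -> : k%:R / e%:R * v%:~R - (m v)%:~R = e%:R^-1 * (k%:R * v%:~R - e%:R * (m v)%:~R) :> rat.
      by field; exact: lt0r_neq0.
    by rewrite normrM gtr0_norm ?invr_gt0 // ltr_pdivrMl.
  - by left.
have [p pL hp] : exists2 p, p \in L & forall v, v \in s -> ~~ (p %| v)%Z.
  apply: (@prime_avoid L s b (M ^ n) c) => //; last by rewrite ss.
    by move=> p /L_ok[].
  by move=> v vs; split; [exact: s0 | exact: leq_trans (hv0 _ vs) small].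
have [pp op bp cp] := L_ok pL; have p0 := prime_gt0 pp.
have pr : (0 : rat) < p%:R by rewrite ltr0n.
have [[j hj]|[j [T [TT_T pT]]]] := cover_check_sound pp op cp ss hp.
  left; exists (j%:~R / p%:R) => v vs m.
  have := dist_mod_min (j * v) m p0; have := hj _ vs => h1 h2.
  have h3 : (p : int) < n.+2%:Z * `|j * v - p%:Z * m| by nia.
  have : (p%:R : rat) < n.+2%:R * `|j%:~R * v%:~R - p%:R * m%:~R|.
    rewrite -[p%:R]/((p : int)%:~R) -[n.+2%:R]/((n.+2 : int)%:~R) -!intrM -intrB -intr_norm -intrM.
    by rewrite ltr_int.
  have -> : j%:~R / p%:R * v%:~R - m%:~R = p%:R^-1 * (j%:~R * v%:~R - p%:R * m%:~R) :> rat.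
    by field; exact: lt0r_neq0.
  rewrite normrM gtr0_norm ?invr_gt0 // => h.
  by rewrite mulrC ltr_pdivlMr // ltr_pdivrMl.
pose m v := near_quo p (j * v).
have mE v : `|j%:~R / p%:R * v%:~R - (m v)%:~R| = (dist_mod p (j * v))%:R / p%:R :> rat.
  have -> : j%:~R / p%:R * v%:~R - (m v)%:~R = p%:R^-1 * (j%:~R * v%:~R - p%:R * (m v)%:~R) :> rat.
    by field; exact: lt0r_neq0.
  rewrite normrM gtr0_norm ?invr_gt0 // mulrC; congr (_ / _).
  by rewrite -[p%:R]/((p : int)%:~R) -!intrM -intrB -intr_norm dist_mod_near.
have amT v : v \in s -> dist_mod p (j * v) \in T by move=> vs; rewrite -(perm_mem pT); exact: (map_f (fun x => dist_mod p (j * x)) vs).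
have [|?|[c' hc]] := @near_period n s (j%:~R / p%:R) m lr ss s0; last 1 first.
- right; have [v1 v1s] : exists v1, v1 \in s by case: (s) ss => // v1 s' _; exists v1; rewrite mem_head.
  have [a0 _] := T_small TT_T (amT _ v1s).
  have cE v : v \in s -> (dist_mod p (j * v))%:R / p%:R = `|c'| * `|v%:~R| :> rat.
    by move=> vs; rewrite -mE hc // normrM.
  have c0 : 0 < `|c'|.
    rewrite lt_neqAle normr_ge0 andbT eq_sym; apply/eqP => c0; have := cE _ v1s.
    by rewrite c0 mul0r => /eqP; rewrite gt_eqF // divr_gt0 // ltr0n.
  exists T, (p%:R^-1 / `|c'|); split=> //.
  have := perm_map (fun x : nat => p%:R^-1 / `|c'| * x%:R : rat) pT; rewrite -map_comp.
  have -> // : [seq ((fun x : nat => p%:R^-1 / `|c'| * x%:R : rat) \o (fun v => dist_mod p (j * v))) v | v <- s] =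
                [seq `|v%:~R| : rat | v <- s].
  apply/eq_in_map => v /cE /= h.
  by rewrite mulrAC [_ * _%:R]mulrC h mulrC mulKf // lt0r_neq0.
- move=> v vs; rewrite mE eta ltr_pdivrMr // ltr_pdivlMl // -natrM ltr_nat.
  have [_] := T_small TT_T (amT _ vs); lia.
- by left.
Qed.
End TightOrLonely.

(** * Five runners *)

Lemma clear_denominators (s : seq rat) : exists (d : int) (s' : seq int),
  0 < d /\ [seq d%:~R * x | x <- s] = [seq v%:~R | v <- s'].
Proof.
elim: s => [|x s [d [s' [d0 e]]]]; first by exists 1, [::].
exists (d * denq x), (d * numq x :: [seq denq x * v | v <- s']).
split; first by rewrite mulr_gt0 // denq_gt0.
rewrite /= -map_comp; congr (_ :: _); first by rewrite !intrM -mulrA [_ * x]mulrC numqE.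
have -> : [seq (d * denq x)%:~R * y | y <- s] = [seq (denq x)%:~R * y | y <- [seq d%:~R * y | y <- s]].
  by rewrite -map_comp; apply: eq_map => y /=; rewrite intrM; ring.
by rewrite e -map_comp; apply: eq_map => v /=; rewrite intrM.
Qed.

(** Rational counterpart of int_tight, with the scaling factor made positive. *)
Definition tight (TT : seq (seq nat)) (s : seq rat) := exists (T : seq nat) (c : rat),
  [/\ T \in TT, 0 < c & perm_eq [seq `|x| | x <- s] [seq c * t%:R | t <- T]].

Definition lonely_or_tight n (TT : seq (seq nat)) := forall s : seq rat,
  size s = n -> (forall x, x \in s -> x != 0) ->
  (exists t, forall x, x \in s -> strictly_far (n.+1%:R^-1) (t * x)) \/ tight TT s.

Lemma lonely_or_tight_rat n TT :
  (forall s : seq int, size s = n.+1 -> (forall v, v \in s -> v != 0) -> strictly_lonely n.+1 s \/ int_tight TT s) ->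
  lonely_or_tight n.+1 TT.
Proof.
move=> h s ss s0; have [d [s' [d0 e]]] := clear_denominators s.
have dr : (0 : rat) < d%:~R by rewrite ltr0z.
have ss' : size s' = n.+1 by rewrite -ss -(size_map (fun v : int => v%:~R : rat)) -e size_map.
have mem x : x \in s -> exists2 v, v \in s' & d%:~R * x = v%:~R.
  by move=> xs; have := map_f (fun x => d%:~R * x) xs; rewrite e => /mapP.
have mem' v : v \in s' -> exists2 x, x \in s & d%:~R * x = v%:~R.
  by move=> vs; have := map_f (fun v : int => v%:~R : rat) vs; rewrite -e => /mapP[x ? ?]; exists x.
have [||[t ht]|[T [c [TT_T pT]]]] := h s' => //.
- move=> v /mem'[x /s0 x0 hv]; rewrite -(intr_eq0 rat) -hv mulf_neq0 //; exact: lt0r_neq0.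
- left; exists (t * d%:~R) => x /mem[v vs hv]; rewrite -mulrA hv; exact: ht.
right; exists T, (c / d%:~R).
have pc : perm_eq [seq `|x| | x <- s] [seq c / d%:~R * t%:R | t <- T].
  have := perm_map (fun x : rat => x / d%:~R) pT; rewrite -!map_comp.
  have -> : [seq ((fun x : rat => x / d%:~R) \o (fun v : int => `|v%:~R|)) v | v <- s'] =
     [seq `|x| / d%:~R | x <- [seq v%:~R | v <- s']] by rewrite -map_comp.
  rewrite -e -map_comp (eq_map (g := fun x : rat => `|x|)).
    by move=> hp; apply: (perm_trans hp); rewrite (eq_map (g := fun t : nat => c / d%:~R * t%:R)) // => t /=; ring.
  by move=> x /=; rewrite normrM (gtr0_norm dr); field; exact: lt0r_neq0.
split=> //.
have [x xs] : exists x, x \in s by case: (s) ss => // x s1 _; exists x; rewrite mem_head.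
have : `|x| \in [seq c / d%:~R * t%:R | t <- T] by rewrite -(perm_mem pc) map_f.
move=> /mapP[t _ hx]; have : 0 < `|x| by rewrite normr_gt0 s0.
by rewrite hx; case: t {hx} => [|t]; rewrite ?mulr0 ?ltxx // pmulr_lgt0 // ltr0n.
Qed.

(** A vector c T is far from the integers at time 1 / (c (n+1)) as soon as
    n+1 divides no entry of T. *)
Lemma lonely_runner_of_tight n TT : lonely_or_tight n TT ->
  (forall T t, T \in TT -> t \in T -> ~~ (n.+1 %| t)%N) -> lonely_runner n.
Proof.
move=> h hT s ss s0; have [[t ht]|[T [c [TT_T c0 pT]]]] := h s ss s0.
  by exists t => x /ht /far_of_strictly_far.
have n0 : (0 : rat) < n.+1%:R by rewrite ltr0n.
exists (c * n.+1%:R)^-1 => x xs.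
have : `|x| \in [seq c * t%:R | t <- T] by rewrite -(perm_mem pT) map_f.
move=> /mapP[t tT hx]; apply: (@far_norm _ (t%:R / n.+1%:R)).
  rewrite [in RHS]normrM hx !ger0_norm ?divr_ge0 ?invr_ge0 ?mulr_ge0 ?ler0n ?ltW //.
  move: (n.+1%:R) n0 => N n0; field; by rewrite !lt0r_neq0.
move=> m.
have -> : t%:R / n.+1%:R - m%:~R = n.+1%:R^-1 * (t%:R - n.+1%:R * m%:~R) :> rat.
  by move: (n.+1%:R) n0 => N n0; field; rewrite lt0r_neq0.
rewrite normrM gtr0_norm ?invr_gt0 // ler_pMr ?invr_gt0 //.
rewrite -[t%:R]/((t : int)%:~R) -[n.+1%:R]/((n.+1 : int)%:~R) -intrM -intrB -intr_norm ler1z.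
rewrite -gtz0_ge1 normr_gt0 subr_eq0; apply: contra (hT _ _ TT_T tT) => /eqP e.
have : (n.+1%:Z %| t%:Z)%Z by rewrite e dvdz_mulr.
by rewrite dvdzE.
Qed.

(** The speed vectors for which 1/(n+1) cannot be exceeded, for n from 2 to
    5. *)
Definition tight2 := [:: [:: 1; 2]]%N.
Definition tight3 := [:: [:: 1; 2; 3]]%N.
Definition tight4 := [:: [:: 1; 2; 3; 4]; [:: 1; 3; 4; 7]]%N.
Definition tight5 := [:: [:: 1; 2; 3; 4; 5]; [:: 1; 3; 4; 5; 9]]%N.

(** The conditions on the primes L, the bound b and the vectors TT that are
    decided by computation. *)
Definition certificate n M b (TT : seq (seq nat)) L :=
  [&& uniq L, all (fun p => [&& prime p, odd p, (b <= p)%N & cover_check n.+1 p TT]) L &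
      all (all (fun t => (0 < t)%N && (t * M < b)%N)) TT].

Lemma lonely_or_tight_of_certificate n M b c TT L : lonely_runner n -> (2 * M = n.+1 * n.+2)%N ->
  certificate n M b TT L -> (n.+1 * c < size L)%N -> (M ^ n < b ^ c.+1)%N ->
  lonely_or_tight n.+1 TT.
Proof.
move=> lr hM /and3P[uL /allP hL /allP hT] sL hb; apply: lonely_or_tight_rat.
apply: (@tight_or_lonely n M b c TT L) => //.
  by move=> p /hL/and4P[].
by move=> T t /hT/allP ht /ht/andP[].
Qed.

Lemma lonely_runner2 : lonely_runner 2.
Proof.
apply: (@lonely_runner_of_tight _ tight2).
  (* M = 3; the prime must exceed 2 * 3, and no speed at most 3 is divisible
     by it. *)
  have hb : (3 ^ 1 < 7 ^ 1)%N by lia.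
  apply: (@lonely_or_tight_of_certificate 1 3 7 0 _ [:: 7%N] lonely_runner1 _ _ _ hb); by vm_compute.
move=> T t; rewrite inE => /eqP->; rewrite !inE => /orP[]/eqP-> //.
Qed.

Lemma lonely_runner3 : lonely_runner 3.
Proof.
apply: (@lonely_runner_of_tight _ tight3).
  (* M = 6; the prime exceeds both 3 * 6 and the bound 36 on the speeds. *)
  have hb : (6 ^ 2 < 47 ^ 1)%N by lia.
  apply: (@lonely_or_tight_of_certificate 2 6 47 0 _ [:: 47%N] lonely_runner2 _ _ _ hb); by vm_compute.
move=> T t; rewrite inE => /eqP->; rewrite !inE => /or3P[]/eqP-> //.
Qed.

Lemma lonely_runner4 : lonely_runner 4.
Proof.
apply: (@lonely_runner_of_tight _ tight4).
  (* M = 10; the primes exceed 7 * 10, and each of the four speeds is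
     divisible by at most one of the five. *)
  have hb : (10 ^ 3 < 79 ^ 2)%N by lia.
  apply: (@lonely_or_tight_of_certificate 3 10 79 1 _ [:: 79; 83; 97; 107; 109]%N lonely_runner3 _ _ _ hb); by vm_compute.
by move=> T t; rewrite !inE => /orP[]/eqP->; rewrite !inE => /or4P[]/eqP-> //.
Qed.

(** The bound M = 15 is 5 * 6 / 2, so these primes must exceed 9 * 15 = 135.
    Since 15 ^ 4 < 149 ^ 3, a speed at most 15 ^ 4 is divisible by at most
    two of them; five speeds rule out at most ten of the eleven. *)
Definition primes5 := [:: 149; 151; 163; 167; 173; 179; 191; 193; 197; 199; 211]%N.

Lemma certificate5 : certificate 4 15 149 tight5 primes5.
Proof. by vm_compute. Qed.

(** The lonely runner theorem for five nonzero speeds, with the cases of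
    equality. *)
Lemma lonely_or_tight5 : lonely_or_tight 5 tight5.
Proof.
have hb : (15 ^ 4 < 149 ^ 3)%N by lia.
apply: (@lonely_or_tight_of_certificate 4 15 149 2 _ _ lonely_runner4 _ certificate5 _ hb); by [].
Qed.

(** * Planes up to coordinate changes *)

Local Notation pt := (rat * rat)%type.

(** The columns are the coordinate forms of a plane, and the plane stays
    within 1/6 of an integer in some coordinate. *)
Definition no_lonely_point (L : seq pt) := forall a b : rat,
  ~ (forall c, c \in L -> strictly_far (6%:R^-1) (a * c.1 + b * c.2)).

(** The representative of a column up to sign, which allows columns up to
    sign to be compared as lists. *)
Definition sign_normal (c : pt) : pt :=
  if (0 < c.1) || ((c.1 == 0) && (0 <= c.2)) then c else - c.

Lemma sign_normalE c : sign_normal c = c \/ sign_normal c = - c.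
Proof. by rewrite /sign_normal; case: ifP; [left|right]. Qed.

Lemma sign_normalN c : sign_normal (- c) = sign_normal c.
Proof.
case: c => x y; rewrite /sign_normal /= !oppr_gt0 oppr_eq0 oppr_ge0 opprK.
have [x0|x0|->] := ltrgtP x 0; rewrite ?eqxx //=.
by have [y0|y0|->] := ltrgtP y 0 => //; exact: (@oppr0 pt).
Qed.

Definition lin (m : pt * pt) (c : pt) : pt := (m.1.1 * c.1 + m.1.2 * c.2, m.2.1 * c.1 + m.2.2 * c.2).

Lemma linN m c : lin m (- c) = - lin m c.
Proof. by case: c => x y; rewrite /lin /= !mulrN -!opprD. Qed.

Lemma sign_normal_lin m c : sign_normal (lin m (sign_normal c)) = sign_normal (lin m c).
Proof. by case: (sign_normalE c) => ->; rewrite // linN sign_normalN. Qed.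

(** Equality of column configurations up to order, signs and a linear change
    of coordinates in the plane. Invertibility of m is not imposed: it
    follows when K has two independent columns. *)
Definition equivalent (L K : seq pt) := exists m,
  perm_eq [seq sign_normal (lin m c) | c <- L] [seq sign_normal c | c <- K].

Lemma equivalent_trans K L L' : equivalent L K -> equivalent K L' -> equivalent L L'.
Proof.
move=> [m hm] [m' hm'].
exists ((m'.1.1 * m.1.1 + m'.1.2 * m.2.1, m'.1.1 * m.1.2 + m'.1.2 * m.2.2),
   (m'.2.1 * m.1.1 + m'.2.2 * m.2.1, m'.2.1 * m.1.2 + m'.2.2 * m.2.2)).
apply: perm_trans hm'; have := perm_map (fun c => sign_normal (lin m' c)) hm; rewrite -!map_comp.
have e1 : (fun c => sign_normal (lin m' c)) \o sign_normal =1 (fun c => sign_normal (lin m' c)).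
  by move=> c /=; rewrite sign_normal_lin.
rewrite (eq_map e1) => h; apply: perm_trans h.
rewrite (_ : map _ _ = [seq ((fun c => sign_normal (lin m' c)) \o (fun c => sign_normal (lin m c))) c | c <- L]) //.
apply: eq_map => c /=; rewrite sign_normal_lin; congr sign_normal.
by rewrite /lin /=; congr pair; ring.
Qed.

Lemma equivalent_perm L K : perm_eq L K -> equivalent L K.
Proof.
move=> h; exists ((1, 0), (0, 1)).
rewrite (eq_map (g := sign_normal)); first exact: perm_map.
by case=> x y; rewrite /lin /= !mul1r !mul0r addr0 add0r.
Qed.

Lemma equivalent_lin L m : equivalent L [seq lin m c | c <- L].
Proof. by exists m; rewrite -map_comp. Qed.

Lemma equivalent_sign L (f : pt -> pt) : (forall c, f c = c \/ f c = - c) -> equivalent L [seq f c | c <- L].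
Proof.
move=> hf; exists ((1, 0), (0, 1)); rewrite -map_comp.
rewrite (eq_map (g := sign_normal \o f)) // => -[x y]; rewrite /lin /= !mul1r !mul0r addr0 add0r.
by case: (hf (x, y)) => ->; rewrite ?sign_normalN.
Qed.

Lemma equivalent_size L K : equivalent L K -> size L = size K.
Proof. by move=> [m /perm_size]; rewrite !size_map. Qed.

(** A point of the plane of K is carried by the transpose of m to a point of
    the plane of L with the same coordinates up to sign. *)
Lemma equivalent_no_lonely_point L K : equivalent L K -> no_lonely_point L -> no_lonely_point K.
Proof.
move=> [m hm] hb a b hK; apply: (hb (a * m.1.1 + b * m.2.1) (a * m.1.2 + b * m.2.2)) => c cL.
have : sign_normal (lin m c) \in [seq sign_normal c | c <- K].
  by rewrite -(perm_mem hm); apply: (map_f (fun c => sign_normal (lin m c))).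
move=> /mapP[k /hK hk e].
have -> : (a * m.1.1 + b * m.2.1) * c.1 + (a * m.1.2 + b * m.2.2) * c.2 =
    a * (lin m c).1 + b * (lin m c).2 by rewrite /lin /=; ring.
have [->|->] : lin m c = k \/ lin m c = - k; last 2 first.
- exact: hk.
- by rewrite /= !mulrN -opprD; apply: strictly_far_opp.
by case: (sign_normalE (lin m c)) (sign_normalE k) e => -> [->|->]; [left|right|move=> <-; right; rewrite opprK|move/oppr_inj; left].
Qed.

Definition adjacent (L : seq pt) i j := [/\ i \in L, j \in L, slope i < slope j &
    forall c, c \in L -> slope c = slope i \/ slope j <= slope c].

(** The line of mediant slope separates the smallest slope from all the
    others. *)
Lemma adjacent_form L i j c : (forall c, c \in L -> 0 < c.1) -> adjacent L i j -> c \in L ->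
  if slope c == slope i then mediant_form i j c < 0 else 0 < mediant_form i j c.
Proof.
move=> L0 [iL jL ij adj] cL; have c0 := L0 _ cL.
have [h1 h2] := andP (mediant_between (L0 _ iL) (L0 _ jL) ij).
rewrite mediant_formE ?lt0r_neq0 //; case: eqP => [->|e].
  by rewrite pmulr_rlt0 // subr_lt0.
by case: (adj _ cL) => // jc; rewrite pmulr_rgt0 // subr_gt0 (lt_le_trans h2).
Qed.

Lemma adjacent_form_neq0 L i j c : (forall c, c \in L -> 0 < c.1) -> adjacent L i j -> c \in L ->
  mediant_form i j c != 0.
Proof.
by move=> L0 a cL; have := adjacent_form L0 a cL; case: ifP => _ h; [exact: ltr0_neq0|exact: lt0r_neq0].
Qed.

(** The merging of two adjacent slopes turns the six columns into five
    speeds. A time lonely for them would be a lonely point of the plane, so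
    the five speeds are tight. *)
Lemma adjacent_tight L i j : size L = 6%N -> (forall c, c \in L -> 0 < c.1) ->
  no_lonely_point L -> adjacent L i j -> tight tight5 [seq mediant_form i j e | e <- rem j L].
Proof.
move=> sL L0 hb a; have [iL jL ij adj] := a.
have [||[t ht]|//] := @lonely_or_tight5 [seq mediant_form i j e | e <- rem j L].
- by rewrite size_map size_rem // sL.
- by move=> x /mapP[e /mem_rem eL ->]; apply: (adjacent_form_neq0 L0 a).
have ir : i \in rem j L.
  have := perm_mem (perm_to_rem jL) i; rewrite iL inE => /esym/orP[/eqP e|//].
  by rewrite e ltxx in ij.
exfalso; apply: (hb (- t * mediant i j) t) => c cL.
have -> : - t * mediant i j * c.1 + t * c.2 = t * mediant_form i j c by rewrite /mediant_form; ring.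
have := perm_mem (perm_to_rem jL) c; rewrite cL inE => /esym/orP[/eqP->|cr].
  rewrite -[mediant_form i j j]opprK -mediant_form_opp ?L0 // mulrN; apply: strictly_far_opp.
  by apply: ht; apply: map_f.
by apply: ht; apply: map_f.
Qed.

Lemma perm_map_lift (S : eqType) (T : eqType) (f : S -> T) (s : seq S) (t : seq T) :
  perm_eq [seq f x | x <- s] t -> exists2 s', perm_eq s s' & [seq f x | x <- s'] = t.
Proof.
elim: t s => [|y t IH] s h.
  by exists [::] => //; move/perm_size: h; case: (s).
have : y \in [seq f x | x <- s] by rewrite (perm_mem h) mem_head.
move=> /mapP[x xs e]; have hx := perm_to_rem xs.
have [|s' hs' e'] := IH (rem x s).
  by have := perm_map f hx; rewrite perm_sym => /perm_trans/(_ h); rewrite /= e perm_cons.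
exists (x :: s'); last by rewrite /= e' e.
by apply: (perm_trans hx); rewrite perm_cons.
Qed.

(** * Two adjacent slopes give a tight vector in the plane *)

Lemma equivalent_flip L : equivalent L [seq flip c | c <- L].
Proof. by apply: equivalent_sign => -[x y]; rewrite /flip; case: ifP => _; [right|left]. Qed.

(** Only finitely many shears send some nonzero column to the vertical axis. *)
Lemma shear_neq0 (L : seq pt) : (forall c, c \in L -> c != 0) ->
  exists N : rat, forall c, c \in L -> c.1 + N * c.2 != 0.
Proof.
move=> L0; pose N := 1 + \sum_(c <- L) `|c.1 / c.2|; exists N => -[x y] cL /=.
have [y0|y0] := eqVneq y 0.
  rewrite y0 mulr0 addr0; apply: contra (L0 _ cL) => /eqP x0.
  by rewrite x0 y0.
have hN : `|x / y| < N.
  have : `|x / y| <= \sum_(c <- L) `|c.1 / c.2|.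
    rewrite (perm_big _ (perm_to_rem cL)) big_cons /= lerDl.
    by apply: sumr_ge0 => c _; apply: normr_ge0.
  by rewrite /N => h; apply: (le_lt_trans h); rewrite ltrDr.
apply: contraTneq hN => e; have -> : x = - N * y by rewrite mulNr; apply/eqP; rewrite -addr_eq0 e.
by rewrite mulfK // normrN -leNgt ler_norm.
Qed.

(** The first coordinates of the columns are those of a tight vector with one
    entry repeated, and the repeated entry occurs on the lowest and on the
    highest slope. *)
Definition normal_chart (K : seq pt) (i j : pt) (T : seq nat) :=
  [/\ forall c, c \in K -> 0 < c.1, i \in K /\ j \in K, i.1 = j.1,
      slope i < slope j /\ (forall c, c \in K -> slope i <= slope c <= slope j) &
      T \in tight5 /\ perm_eq [seq c.1 | c <- K] (i.1 :: [seq t%:R | t <- T])].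

(** Take as first coordinate the form of adjacent_tight, scaled, and as
    second one the old first coordinate. The slope s becomes a multiple of 1
    / (s - r), where r is the mediant slope: so the two slopes next to r
    become the lowest and the highest one. *)
Lemma exists_normal_chart L : size L = 6%N -> no_lonely_point L -> (forall c, c \in L -> 0 < c.1) ->
  (exists c d, [/\ c \in L, d \in L & slope c != slope d]) ->
  exists K i j T, equivalent L K /\ normal_chart K i j T.
Proof.
move=> sL hb L0 /adjacent_slopes[i [j a]]; have [iL jL ij adj] := a.
have [T [c0 [TT_T c0p pT]]] := adjacent_tight sL L0 hb a.
have [h1 h2] := andP (mediant_between (L0 _ iL) (L0 _ jL) ij).
set r := mediant i j in h1 h2.
pose h c := flip (lin ((- r / c0, c0^-1), (1, 0)) c).
have lE c : lin ((- r / c0, c0^-1), (1, 0)) c = (mediant_form i j c / c0, c.1).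
  by rewrite /lin /mediant_form /= -/r; congr pair; [field; exact: lt0r_neq0|ring].
have h0 c : c \in L -> mediant_form i j c / c0 != 0.
  by move=> cL; rewrite mulf_neq0 ?(adjacent_form_neq0 L0 a cL) // invr_eq0 lt0r_neq0.
have hs c : c \in L -> slope (h c) = c0 / (slope c - r).
  move=> cL; rewrite /h slope_flip lE [slope (_, _)]/slope /= mediant_formE ?lt0r_neq0 ?L0 // -/r.
  have : c.1 * (slope c - r) != 0 by have := adjacent_form_neq0 L0 a cL; rewrite mediant_formE // lt0r_neq0 // L0.
  rewrite mulf_eq0 negb_or; move: (slope c - r) (c.1) => u x /andP[x0 u0]; field.
  by rewrite x0 u0 lt0r_neq0.
have h_1 c : c \in L -> (h c).1 = `|mediant_form i j c| / c0.
  move=> cL; rewrite /h lE /flip /=; case: ifP => /= hc.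
    by rewrite -(ltr0_norm hc) normrM [`|c0^-1|]gtr0_norm ?invr_gt0 //.
  by rewrite -[LHS]ger0_norm ?leNgt ?hc // normrM [`|c0^-1|]gtr0_norm ?invr_gt0 //.
(* The form takes opposite values on i and j, so their first coordinates
   agree after flipping. *)
have hij : (h i).1 = (h j).1 by rewrite !h_1 // mediant_form_opp ?L0 // normrN.
exists [seq h c | c <- L], (h i), (h j), T; split.
  apply: (equivalent_trans (equivalent_lin L ((- r / c0, c0^-1), (1, 0)))).
  by rewrite (map_comp flip (lin ((- r / c0, c0^-1), (1, 0)))); apply: equivalent_flip.
split.
- by move=> c /mapP[d dL ->]; apply: flip_gt0; rewrite lE /= h0.
- by rewrite !map_f.
- exact: hij.
- have si : slope (h i) < 0 by rewrite hs // pmulr_rlt0 // invr_lt0 subr_lt0.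
  have sj : 0 < slope (h j) by rewrite hs // pmulr_rgt0 // invr_gt0 subr_gt0.
  split; first exact: lt_trans sj.
  move=> c /mapP[d dL ->]; case: (adj _ dL) => e.
    have -> : slope (h d) = slope (h i) by rewrite !hs // e.
    by rewrite lexx ltW // (lt_trans si).
  have sd : 0 < slope d - r by rewrite subr_gt0 (lt_le_trans h2).
  apply/andP; split; first by rewrite ltW // (lt_trans si) // hs // pmulr_rgt0 // invr_gt0.
  rewrite !hs // ler_pM2l // lef_pV2 ?posrE //; lra.
split=> //; rewrite hij -map_comp.
have := perm_map (fun c => (h c).1) (perm_to_rem jL) => hp.
apply: (perm_trans hp); rewrite /= perm_cons.
have := perm_map (fun x : rat => x / c0) pT; rewrite -!map_comp.
have -> : [seq ((fun x => x / c0) \o (fun t : nat => c0 * t%:R)) t | t <- T] = [seq t%:R | t <- T].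
  by apply: eq_map => t /=; rewrite mulrAC mulfV ?mul1r // lt0r_neq0.
apply: perm_trans; rewrite (_ : map _ _ = [seq (h c).1 | c <- rem j L]) //.
by apply/eq_in_map => c /mem_rem cL /=; rewrite h_1.
Qed.

(** * Planes with three slopes or more *)

Definition int_column := (nat * int)%type.

(** Comparison of slopes by cross-multiplication when j lies above the
    horizontal axis, as it does in admissible. *)
Definition slope_le (c j : int_column) : bool :=
  if c.2 is Posz x then (x * j.1 <= `|j.2| * c.1)%N else true.

(** What merging twice says about the five columns other than the lowest one,
    which is (d, -ph): a column j of highest slope shares its first
    coordinate d; the second merging pairs the lowest column with a column m
    of the next slope and second coordinate ph; and the second coordinate is
    negative only on the lowest slope. *)
Definition admissible (d ph : nat) (zs : seq int_column) : bool :=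
  has (fun j : int_column => [&& j.1 == d, all (fun c => slope_le c j) zs &
    has (fun m : int_column => [&& m.2 == ph, ~~ slope_le j m &
      all (fun c : int_column => if c.2 is Posz x then (ph * c.1 <= x * m.1)%N
                           else (`|c.2| * d == ph * c.1)%N) zs]) zs]) zs.

(** Each triple (N, a, b) stands for the point (a/N, b/N) of the plane. Every
    admissible configuration apart from the exceptions is at distance more
    than 1/6 from the integers at one of them. *)
Definition test_points : seq (nat * nat * nat) :=
  [:: (8, 2, 4); (5, 1, 2); (11, 1, 5); (11, 1, 6); (5, 1, 3); (8, 4, 2); (11, 1, 4); (11, 1, 7);
      (8, 3, 1); (5, 1, 4); (11, 2, 7); (10, 4, 3); (11, 2, 8); (9, 3, 5); (11, 2, 5)]%N.

(** The multiple 2 N is added to a negative entry so that residues can be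
    computed with natural numbers. *)
Definition lonely_at (q : nat * nat * nat) (zs : seq int_column) : bool :=
  let: (N, a, b) := q in
  all (fun c : int_column =>
    let r := if c.2 is Posz x then (a * c.1 + b * x)%N
             else (a * c.1 + b * (2 * N - `|c.2|))%N in
    (`|c.2| <= 2 * N)%N && (N < 6 * fold_mod N (r %% N))%N) zs.

(** Signs that can be given to the second coordinates g: the entry x over t
    is negative only if (t, -x) is on the line of (d, -ph). *)
Fixpoint signings (d ph : nat) (T g : seq nat) : seq (seq int) :=
  match T, g with
  | t :: T', x :: g' => let r := signings d ph T' g' in
      [seq x%:Z :: l | l <- r] ++ (if (x * d == ph * t)%N then [seq (if x is y.+1 then Negz y else 0) :: l | l <- r] else [::])
  | _, _ => [:: [::]]
  end.

(** Both are the configuration columns_C in other coordinates. *)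
Definition exceptions : seq (seq int_column) :=
  [:: [:: (1%N, -1); (1%N, 2 : int); (2%N, 1); (3%N, 3); (4%N, 5); (5%N, 4)];
      [:: (1%N, -1); (1%N, 4 : int); (2%N, 3); (3%N, 2); (4%N, 1); (5%N, 5)]].

(** Enumerates all the pairs of tight vectors with their relative order,
    their signs, and the columns merged at each step. *)
Definition plane_check : bool :=
  all (fun T => all (fun T' => all (fun d => all (fun g => all (fun ph =>
    all (fun fs => let zs := zip T fs in
      admissible d ph zs ==>
        (has (fun q => lonely_at q ((d, if ph is y.+1 then Negz y else 0) :: zs)) test_points ||
         (((d, if ph is y.+1 then Negz y else 0) :: zs) \in exceptions)))
      (signings d ph T g)) T') (permutations T')) T) tight5) tight5.

Lemma plane_checkT : plane_check.
Proof. by lazy. Qed.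

Lemma signingsP d ph T (fs : seq int) : size T = size fs ->
  (forall t x, (t, Negz x) \in zip T fs -> (x.+1 * d = ph * t)%N) ->
  fs \in signings d ph T [seq `|f|%N | f <- fs].
Proof.
elim: T fs => [|t T IH] [|f fs] //= [s] h.
have {}IH : fs \in signings d ph T [seq `|f|%N | f <- fs].
  by apply: IH => // t' f' h'; apply: h; rewrite inE h' orbT.
rewrite mem_cat; case: f h => x h; apply/orP.
  by left; apply: (map_f (cons _)).
have e := h t x (mem_head _ _).
by right; rewrite /= e eqxx; apply: (map_f (cons _)).
Qed.

Definition rat_column (c : int_column) : pt := (c.1%:R, c.2%:~R).

Lemma lonely_at_no_lonely_point q zs : (0 < q.1.1)%N -> lonely_at q zs -> ~ no_lonely_point [seq rat_column c | c <- zs].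
Proof.
case: q => [[N a] b] /= N0 /allP h hb; apply: (hb (a%:R / N%:R) (b%:R / N%:R)) => c /mapP[z zz ->] m.
have Nr : (0 : rat) < N%:R by rewrite ltr0n.
have h3 : (N < 6 * `|(a%:Z * z.1%:Z + b%:Z * z.2 - N%:Z * m)%R|)%N.
  have := h _ zz => /=; case: z {zz h} => t [x|x] /= /andP[xN].
    by rewrite -dist_mod_nat; have := dist_mod_min (a * t + b * x)%N m N0; rewrite PoszD !PoszM; lia.
  rewrite -dist_mod_nat; have := dist_mod_min (a * t + b * (2 * N - x.+1))%N (m + 2 * b) N0.
  by rewrite PoszD !PoszM -subzn // PoszM NegzE; lia.
have -> : a%:R / N%:R * (rat_column z).1 + b%:R / N%:R * (rat_column z).2 - m%:~R =
   N%:R^-1 * (a%:R * z.1%:R + b%:R * z.2%:~R - N%:R * m%:~R).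
  by rewrite /rat_column /=; field; exact: lt0r_neq0.
rewrite normrM gtr0_norm ?invr_gt0 // ltr_pdivlMl // ltr_pdivrMr //.
have -> : a%:R * z.1%:R + b%:R * z.2%:~R - N%:R * m%:~R = (a%:Z * z.1%:Z + b%:Z * z.2 - N%:Z * m)%:~R :> rat.
  by rewrite intrB intrD !intrM.
by rewrite -intr_norm mulrC -[N%:R]/((N : int)%:~R) -[6%:R]/((6 : int)%:~R) -intrM ltr_int; lia.
Qed.

Definition columns_A : seq pt := [:: (1, 0); (2, 0); (3, 0); (4, 0); (5, 0); (0, 1)].
Definition columns_B : seq pt := [:: (1, 0); (3, 0); (4, 0); (5, 0); (9, 0); (0, 1)].
Definition columns_C : seq pt := [:: (1, 0); (0, 1); (1, 1); (2, 1); (3, 1); (3, 2)].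

Lemma exceptions_equivalent zs : zs \in exceptions -> equivalent [seq rat_column c | c <- zs] columns_C.
Proof.
rewrite !inE => /orP[]/eqP->.
  by exists ((1/3, 1/3), (2/3, -1/3)); vm_compute.
by exists ((4/5, -1/5), (1/5, 1/5)); vm_compute.
Qed.

(** In a normal chart, merge the two lowest slopes. The form obtained is a
    second tight vector on the columns other than i; taken as second
    coordinate it is negative exactly on the lowest slope. Thus the
    configuration consists of small integers and is one of those enumerated
    by plane_check. *)
Lemma three_slopes K i j m T : size K = 6%N -> no_lonely_point K -> normal_chart K i j T ->
  adjacent K i m -> slope m < slope j -> equivalent K columns_C.
Proof.
move=> sK hb [K0 [iK jK] ij [sij sb] [TT_T pT]] a mj.
have [T' [c1 [TT_T' c10 pT']]] := adjacent_tight sK K0 hb a.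
have [_ mK im adj] := a.
have [h1 h2] := andP (mediant_between (K0 _ iK) (K0 _ mK) im).
set r := mediant i m in h1 h2.
pose g c : rat := mediant_form i m c / c1.
have gs c : c \in K -> g c = c.1 * (slope c - r) / c1.
  by move=> cK; rewrite /g mediant_formE ?lt0r_neq0 // K0.
have gim : g m = - g i by rewrite /g mediant_form_opp ?K0 // mulNr opprK.
have gi0 : g i < 0.
  by rewrite gs // pmulr_llt0 ?invr_gt0 // pmulr_rlt0 ?K0 // subr_lt0.
have gle c d : c \in K -> d \in K -> (g c * d.1 <= g d * c.1) = (slope c <= slope d).
  move=> cK dK; rewrite !gs //.
  have -> : c.1 * (slope c - r) / c1 * d.1 = (c.1 * d.1 / c1) * (slope c - r) by ring.
  have -> : d.1 * (slope d - r) / c1 * c.1 = (c.1 * d.1 / c1) * (slope d - r) by ring.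
  by rewrite ler_pM2l ?lerD2r // divr_gt0 // mulr_gt0 // K0.
have pi := perm_to_rem iK.
have p1 : perm_eq [seq c.1 | c <- rem i K] [seq t%:R | t <- T].
  have := perm_map (fun c : pt => c.1) pi; rewrite perm_sym /= => h.
  by rewrite -(perm_cons i.1); apply: (perm_trans h).
have p2 : perm_eq [seq `|g c| | c <- rem i K] [seq t%:R | t <- T'].
  rewrite -(perm_cons `|g i|).
  have e1 := perm_map (fun c : pt => `|g c|) pi; rewrite perm_sym in e1; apply: (perm_trans e1).
  apply: (perm_trans (perm_map _ (perm_to_rem mK))); rewrite /= gim normrN perm_cons.
  have := perm_map (fun x : rat => x / c1) pT'; rewrite -!map_comp.
  have -> : [seq ((fun x => x / c1) \o (fun t : nat => c1 * t%:R)) t | t <- T'] = [seq t%:R | t <- T'].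
    by apply: eq_map => t /=; rewrite mulrAC mulfV ?mul1r // lt0r_neq0.
  apply: perm_trans.
  rewrite (_ : [seq `|g c| | c <- rem m K] = [seq `|mediant_form i m c| / c1 | c <- rem m K]) ?perm_refl //.
  by apply: eq_map => c /=; rewrite /g normrM [`|c1^-1|]gtr0_norm ?invr_gt0.
(* Order the columns other than i so that their first coordinates list T. *)
have [R pR eR] := perm_map_lift p1.
have KR : perm_eq K (i :: R) by apply: (perm_trans pi); rewrite perm_cons.
have RK c : c \in R -> c \in K by move=> cR; rewrite (perm_mem KR) inE cR orbT.
pose fs := [seq numq (g c) | c <- R].
have gint c : c \in R -> exists2 t, t \in T' & `|g c| = t%:R.
  move=> cR; have : `|g c| \in [seq t%:R | t <- T'].
    by rewrite -(perm_mem p2); apply: map_f; rewrite (perm_mem pR).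
  by move/mapP.
have gnum c : c \in R -> g c = (numq (g c))%:~R.
  move=> /gint[t _]; case: (ler0P (g c)) => _ e; last by rewrite e -[t%:R]/((t : int)%:~R) numq_int.
  have -> : g c = (- t%:Z)%:~R by rewrite -[LHS]opprK e mulrNz.
  by rewrite numq_int.
have sR : size R = 5%N by have := perm_size KR; rewrite sK => -[].
have [d dT di] : exists2 d, d \in T & i.1 = d%:R.
  have : j.1 \in [seq c.1 | c <- R].
    apply: map_f; have := perm_mem KR j; rewrite jK inE => /esym/orP[/eqP e|//].
    by rewrite e ltxx in sij.
  by rewrite eR -ij => /mapP.
have mR : m \in R.
  have := perm_mem KR m; rewrite mK inE => /esym/orP[/eqP e|//].
  by rewrite e ltxx in im.
have jR : j \in R.
  have := perm_mem KR j; rewrite jK inE => /esym/orP[/eqP e|//].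
  by rewrite e ltxx in sij.
have gm0 : 0 < g m by rewrite gim oppr_gt0.
have [ph phT' phm] : exists2 ph, ph \in T' & g m = ph%:R.
  by have [t tT' e] := gint _ mR; exists t; rewrite // -e gtr0_norm.
have zsE : [seq rat_column z | z <- zip T fs] = [seq (c.1, g c) | c <- R].
  rewrite /fs; elim: (R) (T) eR gnum => [|c R' IH] [|t T1] //= [e1 e2] gn.
  rewrite /rat_column /= e1 -gn ?mem_head // -/rat_column; congr cons; apply: IH => // c' c'R.
  by apply: gn; rewrite inE c'R orbT.
have zR z : z \in zip T fs -> exists2 c, c \in R & rat_column z = (c.1, g c).
  by move=> /(map_f rat_column); rewrite zsE => /mapP.
have Rz c : c \in R -> exists2 z, z \in zip T fs & rat_column z = (c.1, g c).
  by move=> /(map_f (fun c : pt => (c.1, g c))); rewrite -zsE => /mapP[z ? ?]; exists z.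
set W := (d, if ph is y.+1 then Negz y else 0) :: zip T fs.
have iW : (i.1, g i) = rat_column (d, if ph is y.+1 then Negz y else 0).
  rewrite /rat_column /= di -[g i]opprK -gim phm.
  by case: (ph) => [|y]; rewrite ?oppr0 // NegzE mulrNz.
have KW : equivalent K [seq rat_column z | z <- W].
  apply: (equivalent_trans (equivalent_lin K ((1, 0), (- r / c1, c1^-1)))).
  rewrite (_ : [seq lin ((1, 0), (- r / c1, c1^-1)) c | c <- K] = [seq (c.1, g c) | c <- K]).
    by apply/equivalent_perm; rewrite /= zsE -iW; apply: (perm_map (fun c : pt => (c.1, g c)) KR).
  apply: eq_map => c; rewrite /lin /g /mediant_form /= -/r mul1r mul0r addr0; congr pair.
  by rewrite mulNr mulrC addrC; ring.
apply: (equivalent_trans KW).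
have := plane_checkT => /allP/(_ _ TT_T)/allP/(_ _ TT_T')/allP/(_ _ dT)/allP.
have pfs : [seq `|f|%N | f <- fs] \in permutations T'.
  rewrite mem_permutations; apply/(@perm_map_inj _ _ (fun n : nat => n%:R : rat)).
    by move=> x y /eqP; rewrite eqr_nat => /eqP.
  apply: perm_trans p2; rewrite perm_sym.
  apply: (perm_trans (perm_map _ pR)); rewrite /fs -!map_comp.
  rewrite (_ : [seq `|g c| | c <- R] = [seq ((fun n : nat => n%:R : rat) \o (absz \o (fun c => numq (g c)))) c | c <- R]) //.
  by apply/eq_in_map => c cR /=; rewrite natr_absz intr_norm -gnum.
move=> /(_ _ pfs)/allP/(_ _ phT')/allP.
have sT : size T = size fs by rewrite size_map -(size_map (fun c : pt => c.1) R) eR size_map.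
(* A column with negative second coordinate is on the line of i. *)
have gneg c : c \in K -> g c < 0 -> g c * i.1 = g i * c.1.
  move=> cK gc; apply/eqP; rewrite eq_le !gle //.
  case: (adj _ cK) => [->|mc]; first by rewrite lexx.
  move: mc; rewrite -gle // => mc; exfalso.
  have : g m * c.1 <= 0 by apply: (le_trans mc); rewrite mulr_le0_ge0 // ltW // K0.
  by rewrite leNgt mulr_gt0 // K0.
have fsS : fs \in signings d ph T [seq `|f|%N | f <- fs].
  apply: signingsP => // t x /zR[c cR [e1 e2]].
  have := gneg c (RK _ cR); rewrite -e1 -e2 di NegzE mulrNz oppr_lt0 ltr0z => /(_ isT).
  rewrite -[g i]opprK -gim phm !mulNr => /oppr_inj.
  by rewrite -[x.+1%:~R]/(x.+1%:R) -!natrM => /eqP; rewrite eqr_nat => /eqP.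
move=> /(_ _ fsS)/implyP.
have adm : admissible d ph (zip T fs).
  have [zj zjs ej] := Rz _ jR; have [zm zms em] := Rz _ mR.
  have gj0 : 0 < g j.
    have := gle m j mK jK; rewrite (ltW mj) => h; have : 0 < g j * m.1.
      by apply: lt_le_trans h; rewrite mulr_gt0 // K0.
    by rewrite pmulr_lgt0 // K0.
  apply/hasP; exists zj => //.
  have [ej1 ej2] : zj.1%:R = j.1 /\ zj.2%:~R = g j by case: ej.
  have [em1 em2] : zm.1%:R = m.1 /\ zm.2%:~R = g m by case: em.
  have zm2 : zm.2 = ph by apply/eqP; rewrite -(eqr_int rat) em2 phm.
  apply/and3P; split.
  - by rewrite -(eqr_nat rat) ej1 -ij di.
  - apply/allP => z /zR[c cR [e1 e2]]; rewrite /slope_le; case: z e1 e2 => t [x|//] /= e1 e2.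
    have := gle c j (RK _ cR) jK; have [_ ->] := andP (sb _ (RK _ cR)).
    rewrite -e1 -e2 -ej1 -ej2 -[t%:R]/((t : int)%:~R) -[zj.1%:R]/((zj.1 : int)%:~R) -!intrM ler_int => h.
    have : (0 : rat) < zj.2%:~R by rewrite ej2.
    by rewrite ltr0z; case: (zj) h => t' [y|//] /= h _; rewrite -!PoszM lez_nat in h.
  - apply/hasP; exists zm => //; apply/and3P; split; first by rewrite zm2.
      have := gle j m jK mK; rewrite [slope j <= _]leNgt mj /= /slope_le.
      have : (0 : rat) < zj.2%:~R by rewrite ej2.
      rewrite -ej1 -ej2 -em1 -em2 -[zm.1%:R]/((zm.1 : int)%:~R) -[zj.1%:R]/((zj.1 : int)%:~R) -!intrM ler_int ltr0z zm2.
      by case: (zj) => t [x|//] /= _; rewrite -!PoszM lez_nat => ->.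
    apply/allP => z /zR[c cR [e1 e2]]; case: z e1 e2 => t [x|x] /= e1 e2; last first.
      have := gneg c (RK _ cR); rewrite -e1 -e2 di NegzE mulrNz oppr_lt0 ltr0z => /(_ isT).
      rewrite -[g i]opprK -gim phm !mulNr => /oppr_inj.
      by rewrite -[x.+1%:~R]/(x.+1%:R) -!natrM => /eqP; rewrite eqr_nat.
    have mc : slope m <= slope c.
      case: (adj _ (RK _ cR)) => // e; have : g c < 0.
        by rewrite gs ?RK // e pmulr_llt0 ?invr_gt0 // pmulr_rlt0 ?K0 ?RK // subr_lt0.
      by rewrite -e2 ltrz0.
    by move: mc; rewrite -gle ?RK // -e1 -e2 -em1 phm -[x%:~R]/(x%:R) -!natrM ler_nat.
move=> /(_ adm)/orP[/hasP[q qp ql]|]; last exact: exceptions_equivalent.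
exfalso; apply: (lonely_at_no_lonely_point _ ql); last exact: equivalent_no_lonely_point KW hb.
by have /allP/(_ _ qp) : all (fun q : nat * nat * nat => 0 < q.1.1)%N test_points by [].
Qed.

(** * Planes with two slopes, and all planes *)

(** Four runners or fewer reach 1/5, which exceeds 1/6. *)
Lemma lonely_few (s : seq rat) : (0 < size s <= 4)%N -> (forall x, x \in s -> x != 0) ->
  exists t, forall x, x \in s -> strictly_far 6%:R^-1 (t * x).
Proof.
move=> sz s0; have lr : lonely_runner (size s).
  by case: (size s) sz => [|[|[|[|[|n]]]]] // _; [exact: lonely_runner1|exact: lonely_runner2|exact: lonely_runner3|exact: lonely_runner4].
have [t ht] := lr s erefl s0; exists t => x /ht h m; apply: lt_le_trans (h m).
rewrite ltf_pV2 ?posrE ?ltr0n // ltr_nat; case/andP: sz => _ h4.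
exact: leq_ltn_trans (_ : _ <= 5)%N _.
Qed.

Definition lin_form (a b : rat) (c : pt) := a * c.1 + b * c.2.

(** With one column x outside a line that carries the five others,
    coordinates adapted to the line and to x show a tight vector and a unit
    vector. *)
Lemma tight_pencil K x B a b a' b' : perm_eq K (x :: B) ->
  lin_form a b x = 0 -> lin_form a' b' x != 0 -> (forall c, c \in B -> lin_form a' b' c = 0) ->
  tight tight5 [seq lin_form a b c | c <- B] -> equivalent K columns_A \/ equivalent K columns_B.
Proof.
move=> KB' ux wx wB [T [c0 [TT_T c0p pT]]].
suff : equivalent K (rcons [seq (t%:R, 0) | t <- T] (0, 1)).
  by move: TT_T; rewrite !inE => /orP[]/eqP->; [left|right].
set w0 := lin_form a' b' x in wx.
exists ((a / c0, b / c0), (a' / w0, b' / w0)).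
have lE c : lin ((a / c0, b / c0), (a' / w0, b' / w0)) c = (lin_form a b c / c0, lin_form a' b' c / w0).
  by rewrite /lin /lin_form /=; congr pair; ring.
apply: (perm_trans (perm_map _ KB')); rewrite map_rcons perm_sym perm_rcons perm_sym /=.
have -> : sign_normal (lin ((a / c0, b / c0), (a' / w0, b' / w0)) x) = sign_normal (0, 1).
  by rewrite lE ux mul0r mulfV.
rewrite perm_cons -map_comp.
have nr0 (y : rat) : 0 <= y -> sign_normal (y, 0) = (y, 0).
  by rewrite /sign_normal /= lexx andbT le_eqVlt eq_sym orbC => ->.
have p1 : perm_eq [seq (`|lin_form a b c| / c0, 0 : rat) | c <- B] [seq (t%:R, 0 : rat) | t <- T].
  rewrite (_ : [seq (t%:R, 0 : rat) | t <- T] = [seq (y / c0, 0 : rat) | y <- [seq c0 * t%:R | t <- T]]).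
    rewrite (_ : [seq _ | c <- B] = [seq (y / c0, 0 : rat) | y <- [seq `|x| | x <- [seq lin_form a b c | c <- B]]]).
      exact: perm_map.
    by rewrite -!map_comp.
  by rewrite -map_comp; apply: eq_map => t /=; rewrite mulrAC mulfV ?mul1r // lt0r_neq0.
rewrite [X in perm_eq _ X](_ : _ = [seq (t%:R, 0 : rat) | t <- T]); last first.
  by apply: eq_map => t /=; rewrite nr0 ?ler0n.
rewrite [X in perm_eq X _](_ : _ = [seq (`|lin_form a b c| / c0, 0 : rat) | c <- B]) //.
apply/eq_in_map => c cB; rewrite lE wB // mul0r.
have [h|h] := lerP 0 (lin_form a b c / c0).
  by rewrite nr0 // -[LHS]/(_, _) -{1}(ger0_norm h) normrM [`|c0^-1|]gtr0_norm ?invr_gt0.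
rewrite -sign_normalN -[- (_, _)]/(- _, - _) oppr0 nr0 ?oppr_ge0 ?ltW //.
by rewrite -(ltr0_norm h) normrM [`|c0^-1|]gtr0_norm ?invr_gt0.
Qed.

(** If all the columns lie on two lines, the plane is a product and each
    group of columns has a time of its own. A group of at most four columns
    has a lonely time, so one group consists of five columns, and these are
    tight. *)
Lemma two_slopes K i j : size K = 6%N -> no_lonely_point K -> (forall c, c \in K -> 0 < c.1) ->
  i \in K -> j \in K -> slope i < slope j ->
  (forall c, c \in K -> slope c = slope i \/ slope c = slope j) -> equivalent K columns_A \/ equivalent K columns_B.
Proof.
move=> sK hb K0 iK jK ij hs.
set s1 := slope i in ij hs; set s2 := slope j in ij hs.
pose A := [seq c <- K | slope c == s1]; pose B := [seq c <- K | slope c != s1].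
have pK : perm_eq K (A ++ B) by rewrite perm_sym perm_filterC.
have u_slope s c : c \in K -> lin_form (- s) 1 c = c.1 * (slope c - s).
  by move=> cK; rewrite /lin_form /slope; field; exact: lt0r_neq0 (K0 _ cK).
have uA c : c \in A -> lin_form (- s1) 1 c = 0.
  by rewrite mem_filter => /andP[/eqP e cK]; rewrite u_slope // e subrr mulr0.
have uB c : c \in B -> lin_form (- s1) 1 c != 0.
  by rewrite mem_filter => /andP[e cK]; rewrite u_slope //; apply: mulf_neq0; [exact: lt0r_neq0 (K0 _ cK)|rewrite subr_eq0].
have wB c : c \in B -> lin_form (- s2) 1 c = 0.
  rewrite mem_filter => /andP[e cK]; rewrite u_slope //; case: (hs _ cK) => e'; first by rewrite e' eqxx in e.
  by rewrite e' subrr mulr0.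
have wA c : c \in A -> lin_form (- s2) 1 c != 0.
  by rewrite mem_filter => /andP[/eqP e cK]; rewrite u_slope // e; apply: mulf_neq0; [exact: lt0r_neq0 (K0 _ cK)|rewrite subr_eq0 lt_eqF].
have iA : i \in A by rewrite mem_filter eqxx.
have jB : j \in B by rewrite mem_filter jK andbT gt_eqF.
have sAB : (size A + size B = 6)%N by rewrite -size_cat -(perm_size pK).
(* A time for each group would combine into a lonely point. *)
have noboth : ~ ((exists t, forall x, x \in [seq lin_form (- s2) 1 c | c <- A] -> strictly_far 6%:R^-1 (t * x)) /\
               (exists t, forall x, x \in [seq lin_form (- s1) 1 c | c <- B] -> strictly_far 6%:R^-1 (t * x))).
  move=> [[t ht] [t' ht']]; apply: (hb (- (t * s2 + t' * s1)) (t + t')) => c.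
  have -> : - (t * s2 + t' * s1) * c.1 + (t + t') * c.2 =
      t * lin_form (- s2) 1 c + t' * lin_form (- s1) 1 c by rewrite /lin_form; ring.
  rewrite (perm_mem pK) mem_cat => /orP[cA|cB].
    by rewrite uA // mulr0 addr0; apply: ht; apply: map_f.
  by rewrite wB // mulr0 add0r; apply: ht'; apply: map_f.
have nzA x : x \in [seq lin_form (- s2) 1 c | c <- A] -> x != 0 by move=> /mapP[c cA ->]; exact: wA.
have nzB x : x \in [seq lin_form (- s1) 1 c | c <- B] -> x != 0 by move=> /mapP[c cB ->]; exact: uB.
have A0 : (0 < size A)%N by case: (A) iA.
have B0 : (0 < size B)%N by case: (B) jB.
have [A4|A5] := leqP (size A) 4; last first.
  have sA : size A = 5%N by apply/eqP; rewrite eqn_leq A5 andbT -(leq_add2r 1) -[(5 + 1)%N]sAB leq_add2l.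
  have sB : size B = 1%N by move: sAB; rewrite sA => -[].
  have [||h|ht] := @lonely_or_tight5 [seq lin_form (- s2) 1 c | c <- A] => //; first by rewrite size_map.
    by exfalso; apply: noboth; split=> //; apply: lonely_few => //; rewrite size_map sB.
  case: (B) sB jB wB uB pK => [//|x [|//]] _ _ wB uB pK.
  apply: (@tight_pencil K x A (- s2) 1 (- s1) 1) => //.
  - by rewrite (perm_trans pK) // perm_catC.
  - by rewrite wB ?mem_head.
  - by rewrite uB ?mem_head.
have [B4|B5] := leqP (size B) 4.
  by exfalso; apply: noboth; split; apply: lonely_few => //; rewrite size_map ?A0 ?B0.
have sB : size B = 5%N by apply/eqP; rewrite eqn_leq B5 andbT -(leq_add2l 1) -[(1 + 5)%N]sAB leq_add2r.
have sA : size A = 1%N by move/eqP: sAB; rewrite sB -[6%N]/(1 + 5)%N eqn_add2r => /eqP.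
have [||h|ht] := @lonely_or_tight5 [seq lin_form (- s1) 1 c | c <- B] => //; first by rewrite size_map.
  by exfalso; apply: noboth; split=> //; apply: lonely_few => //; rewrite size_map sA.
case: (A) sA iA wA uA pK => [//|x [|//]] _ _ wA uA pK.
apply: (@tight_pencil K x B (- s1) 1 (- s2) 1) => //.
- by rewrite uA ?mem_head.
- by rewrite wA ?mem_head.
Qed.

(** After a shear the first coordinates are nonzero and exists_normal_chart
    applies. If the two lowest slopes of the chart are its extreme slopes,
    there are only two slopes; otherwise three_slopes applies. *)
Theorem classify_planes L : size L = 6%N -> (forall c, c \in L -> c != 0) ->
  (exists c d, [/\ c \in L, d \in L & c.1 * d.2 != c.2 * d.1]) -> no_lonely_point L ->
  [\/ equivalent L columns_A, equivalent L columns_B | equivalent L columns_C].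
Proof.
move=> sL L0 [c [d [cL dL cd]]] hb.
have [N hN] := shear_neq0 L0.
pose h c := flip (lin ((1, N), (0, 1)) c).
have lE e : lin ((1, N), (0, 1)) e = (e.1 + N * e.2, e.2).
  by rewrite /lin /= !mul1r mul0r add0r.
have LK : equivalent L [seq h c | c <- L].
  apply: (equivalent_trans (equivalent_lin L ((1, N), (0, 1)))).
  by rewrite (map_comp flip (lin ((1, N), (0, 1)))); apply: equivalent_flip.
have hb1 := equivalent_no_lonely_point LK hb.
have s1 : size [seq h c | c <- L] = 6%N by rewrite size_map.
have [||K [i [j [T [EK cK]]]]] := exists_normal_chart s1 hb1.
- by move=> e /mapP[f fL ->]; apply: flip_gt0; rewrite lE /= hN.
- exists (h c), (h d); rewrite !map_f // !slope_flip !lE /slope /=; split=> //.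
  apply: contra cd; rewrite eqr_div ?hN // => /eqP e.
  by apply/eqP; lra.
have EL := equivalent_trans LK EK.
have sK : size K = 6%N by rewrite -(equivalent_size EL).
have bK := equivalent_no_lonely_point EL hb.
have [K0 [iK jK] ij [sij sb] _] := cK.
have [|i' [m [i'K mK im adj]]] := @adjacent_slopes K.
  by exists i, j; rewrite iK jK lt_eqF.
have ei : slope i' = slope i.
  case: (adj _ iK) => [->//|mi]; have /andP[h1 _] := sb _ i'K.
  by have := le_lt_trans h1 (lt_le_trans im mi); rewrite ltxx.
have a : adjacent K i m by split=> //; rewrite -ei.
have [mj|jm] := ltP (slope m) (slope j).
  by apply: Or33; apply: (equivalent_trans EL); exact: three_slopes sK bK cK a mj.
have : equivalent K columns_A \/ equivalent K columns_B.
  apply: (two_slopes sK bK K0 iK jK sij) => // e eK; have [_ _ _ ad] := a.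
  case: (ad _ eK) => [|me]; [by left|right]; apply/eqP.
  by rewrite eq_le (le_trans jm me) andbT; have /andP[] := sb _ eK.
by case=> h1; [apply: Or31|apply: Or32]; apply: (equivalent_trans EL).
Qed.

Local Open Scope classical_set_scope.

(** * Loneliness in the torus *)

Section DistInt.
Variable R : realType.
Implicit Types x y k : R.

Lemma dist_int_ge x k : (forall m : int, k <= `|x - m%:~R|) -> k <= dist_int x.
Proof.
move=> h; apply: lb_le_inf; first by exists `|x - 0%:~R|, 0.
by move=> _ [m _ <-].
Qed.

Lemma dist_int_le x (m : int) : dist_int x <= `|x - m%:~R|.
Proof.
apply: ge_inf; last by exists m.
by exists 0 => _ [n _ <-].
Qed.

(** The infimum is attained, at the floor of x or at the next integer; hence
    a strict inequality is inherited. *)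
Lemma dist_int_gt x k : (forall m : int, k < `|x - m%:~R|) -> k < dist_int x.
Proof.
move=> h; have /andP[f1 f2] := Num.Theory.floor_itv x; set f := Num.floor x in f1 f2.
rewrite intrD in f2.
apply: (@lt_le_trans _ _ (Num.min `|x - f%:~R| `|x - (f + 1)%:~R|)).
  by rewrite lt_min !h.
apply: dist_int_ge => m; rewrite ge_min; have [mf|fm] := lerP m f.
  have : m%:~R <= f%:~R :> R by rewrite ler_int.
  by move=> hm; apply/orP; left; rewrite !ger0_norm; lra.
have : (f + 1)%:~R <= m%:~R :> R by rewrite ler_int; lia.
move=> hm; apply/orP; right; have e : (f + 1)%:~R = f%:~R + 1 :> R by rewrite intrD.
by rewrite !ler0_norm; lra.
Qed.

End DistInt.

Section Torus.
Variables (R : realType) (n : nat).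
Implicit Types (u v : 'rV[int]_n) (x : torus R n).

Lemma min_norm_proj (y : 'rV[R]_n) :
  min_norm (torus_proj y) = \big[Num.min/2^-1]_(r < n) dist_int (y 0 r).
Proof. by apply: eq_bigr => r _; rewrite mxE circle_norm_pi. Qed.

Lemma min_norm_le_half x : min_norm x <= 2^-1.
Proof. exact: bigmin_le_id. Qed.

Lemma min_norm_le_ML (X : set (torus R n)) x : X x -> min_norm x <= ML X.
Proof.
move=> Xx; apply: ub_le_sup; last by exists x.
by exists 2^-1 => _ [y _ <-]; apply: min_norm_le_half.
Qed.

Lemma ML_le (X : set (torus R n)) k : X !=set0 -> (forall x, X x -> min_norm x <= k) -> ML X <= k.
Proof.
move=> [x Xx] h; apply: ge_sup; first by exists (min_norm x), x.
by move=> _ [y Xy <-]; apply: h.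
Qed.

Definition plane_pt u v (s t : R) : 'rV[R]_n := s *: real_row R u + t *: real_row R v.

Lemma plane_ptE u v s t r : plane_pt u v s t 0 r = s * (u 0 r)%:~R + t * (v 0 r)%:~R.
Proof. by rewrite !mxE. Qed.

Lemma planeP u v x : plane R u v x <-> exists s t, x = torus_proj (plane_pt u v s t).
Proof.
split=> [[s _ [t _ <-]]|[s [t ->]]]; first by exists s, t.
by exists s => //; exists t.
Qed.
End Torus.

(** * From subtori to configurations of columns *)

Definition column n (u v : 'rV[int]_n) (r : 'I_n) : rat * rat := ((u 0 r)%:~R, (v 0 r)%:~R).
Definition columns n (u v : 'rV[int]_n) := [seq column u v r | r <- enum 'I_n].

Lemma columnsP n (u v : 'rV[int]_n) c : reflect (exists r, c = column u v r) (c \in columns u v).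
Proof.
apply: (iffP mapP) => [[r _ ->]|[r ->]]; first by exists r.
by exists r; rewrite ?mem_enum.
Qed.

Section Bridge.
Variable R : realType.

(** Rational points of the plane are real points of the subtorus. *)
Lemma ML_gt_of_lonely n (u v : 'rV[int]_n) (a b : rat) :
  (forall r, strictly_far 6%:R^-1 (a * (column u v r).1 + b * (column u v r).2)) ->
  6%:R^-1 < ML (plane R u v).
Proof.
move=> h; pose x := torus_proj (plane_pt u v (ratr a) (ratr b : R)).
have xU : plane R u v x by apply/planeP; exists (ratr a), (ratr b).
apply: lt_le_trans (min_norm_le_ML xU); rewrite min_norm_proj; apply/bigmin_gtP; split.
  by rewrite ltf_pV2 ?posrE ?ltr0n // ltr_nat.
move=> r _; apply: dist_int_gt => m; rewrite plane_ptE.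
have e6 : ratr (6%:R^-1) = 6%:R^-1 :> R by rewrite fmorphV /= ratr_nat.
have := h r m; rewrite /column /= -(ltr_rat R) e6 ratr_norm !rmorphB rmorphD !rmorphM /=.
by rewrite !ratr_int.
Qed.

Lemma columns_no_lonely_point n (u v : 'rV[int]_n) : D (plane R u v) = 3^-1 -> no_lonely_point (columns u v).
Proof.
rewrite /D => hD a b h; have : 6%:R^-1 < ML (plane R u v).
  by apply: (@ML_gt_of_lonely _ _ _ a b) => r; apply: h; apply/columnsP; exists r.
move: hD; move: (ML _) => M; lra.
Qed.

Lemma free_pairP n (x y : 'rV[R]_n) : reflect (forall s t, s *: x + t *: y = 0 -> s = 0 /\ t = 0) (free [:: x; y]).
Proof.
apply: (iffP (@freeP _ _ 2 [tuple x; y])) => h.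
  move=> s t e; have := h (fun i : 'I_2 => if val i == 0%N then s else t).
  rewrite !big_ord_recl big_ord0 /= addr0 => /(_ e) h'.
  by split; [apply: (h' ord0)|apply: (h' (lift ord0 ord0))].
move=> k; rewrite !big_ord_recl big_ord0 /= addr0 => /h[h0 h1] i.
by case: (unliftP ord0 i) => [j|] ->; rewrite ?[j]ord1.
Qed.

(** If all the minors containing one given nonzero column vanish, the two
    rows are proportional. *)
Lemma free_minor n (u v : 'rV[int]_n) : free [:: real_row R u; real_row R v] ->
  (forall r, column u v r != 0) ->
  exists c d, [/\ c \in columns u v, d \in columns u v & c.1 * d.2 != c.2 * d.1].
Proof.
move=> /free_pairP hf h0.
have [r0 _|no] := pickP (fun _ : 'I_n => true); last first.
  exfalso; have [|/eqP] := hf 1 0; last by rewrite oner_eq0.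
  by apply/rowP => r; have := no r.
have [[r hr]|hno] := pselect (exists r, (u 0 r0) * (v 0 r) != (v 0 r0) * (u 0 r)).
  exists (column u v r0), (column u v r); split; [by apply/columnsP; exists r0|by apply/columnsP; exists r|].
  by rewrite /column /= -!intrM eqr_int.
have [|e1 e2] := hf (v 0 r0)%:~R (- (u 0 r0)%:~R).
  apply/rowP => r; rewrite !mxE mulNr -!intrM -intrB.
  suff -> : v 0 r0 * u 0 r - u 0 r0 * v 0 r = 0 by [].
  by apply/eqP; rewrite subr_eq0 eq_sym; apply/negPn/negP => e; apply: hno; exists r.
have := h0 r0; rewrite /column => /negP[]; apply/eqP; congr pair; apply/eqP; rewrite intr_eq0 -(intr_eq0 R).
  by rewrite -oppr_eq0 e2.
by rewrite e1.
Qed.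

(** A zero column would put the subtorus into a coordinate hyperplane. *)
Lemma proper_columns n (u v : 'rV[int]_n) : proper_subtorus (plane R u v) -> forall r, column u v r != 0.
Proof.
move=> hp r; apply/eqP => -[/eqP]; rewrite intr_eq0 => /eqP ur /eqP; rewrite intr_eq0 => /eqP vr.
apply: hp => _ /planeP[s [t ->]]; exists r.
by rewrite mxE plane_ptE ur vr !mulr0 addr0 raddf0.
Qed.

(** The permutation of the normalised columns gives s, and eps records where
    the normal form has changed the sign. *)
Lemma equivalent_columns n (u v : 'rV[int]_n) (K : seq (rat * rat)) : size K = n -> equivalent (columns u v) K ->
  exists (m : (rat * rat) * (rat * rat)) (s : 'S_n) (eps : {ffun 'I_n -> bool}), forall r : 'I_n,
    nth 0 K r = (if eps r then - lin m (column u v (s r)) else lin m (column u v (s r))).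
Proof.
move=> sK [m]; pose t := [tuple sign_normal (lin m (column u v r)) | r < n].
have -> : [seq sign_normal (lin m c) | c <- columns u v] = t.
  by rewrite /columns -map_comp.
rewrite perm_sym => /tuple_permP[p hp].
have h (r : 'I_n) : sign_normal (nth 0 K r) = sign_normal (lin m (column u v (p r))).
  have := congr1 (fun l => nth 0 l r) hp; rewrite (nth_map 0) ?sK // => ->.
  by rewrite -tnth_nth !tnth_mktuple.
exists m, p, [ffun r : 'I_n => nth 0 K r != lin m (column u v (p r))] => r; rewrite ffunE.
case: eqP => //= ne.
by case: (sign_normalE (nth 0 K r)) (sign_normalE (lin m (column u v (p r)))) (h r) => -> [->|->] // e;
  rewrite -?e ?opprK // -[LHS]opprK e opprK in ne *.
Qed.
End Bridge.

(** * The three extremal subtori *)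

Section Extremal.
Variable R : realType.

(** The parameters of one plane are the image of those of the other by the
    transpose of m, which is onto as m is invertible. *)
Lemma signed_perm_plane n (u v u' v' : 'rV[int]_n) m (s : 'S_n) (eps : {ffun 'I_n -> bool}) :
  m.1.1 * m.2.2 != m.1.2 * m.2.1 ->
  (forall r, column u' v' r = if eps r then - lin m (column u v (s r)) else lin m (column u v (s r))) ->
  signed_perm s eps @` plane R u v = plane R u' v'.
Proof.
move: m => [[a b] [c d]] /= hdet h.
have img (x y : R) : signed_perm s eps (torus_proj (plane_pt u v (x * ratr a + y * ratr c) (x * ratr b + y * ratr d)))
    = torus_proj (plane_pt u' v' x y).
  apply/rowP => r; rewrite !mxE.
  have [e1 e2] : (u' 0 r)%:~R = (-1) ^+ eps r * (ratr a * (u 0 (s r))%:~R + ratr b * (v 0 (s r))%:~R) :> R /\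
      (v' 0 r)%:~R = (-1) ^+ eps r * (ratr c * (u 0 (s r))%:~R + ratr d * (v 0 (s r))%:~R) :> R.
    have := h r; rewrite /column /lin /=; case: (eps r) => -[e1 e2]; split;
      rewrite -[LHS](ratr_int R) ?e1 ?e2 ?expr1 ?expr0 ?mulN1r ?mul1r ?rmorphN rmorphD !rmorphM /= !ratr_int //.
  rewrite !e1 !e2; case: (eps r); rewrite ?expr1 ?expr0 ?mulN1r ?mul1r.
    by rewrite -raddfN /=; congr (\pi _)%qT; ring.
  by congr (\pi _)%qT; ring.
apply/seteqP; split=> [_ [_ /planeP[x [y ->]] <-]|_ /planeP[x [y ->]]]; last first.
  exists (torus_proj (plane_pt u v (x * ratr a + y * ratr c) (x * ratr b + y * ratr d))) => //.
  by apply/planeP; do 2!eexists.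
have dt : ratr a * ratr d - ratr b * ratr c != 0 :> R.
  by rewrite -!rmorphM -rmorphB fmorph_eq0 subr_eq0.
set dd := _ - _ in dt.
apply/planeP; exists ((x * ratr d - y * ratr c) / dd), ((y * ratr a - x * ratr b) / dd).
rewrite -img; congr (signed_perm _ _ (torus_proj (plane_pt _ _ _ _))); rewrite /dd; field; exact: dt.
Qed.

(** The point with parameters (a/6, b/6) has all its coordinates in the
    nonzero multiples of 1/6 modulo 1, so ML is at least 1/6; the second
    condition says that it is at most 1/6. *)
Lemma D_third n (u v : 'rV[int]_n) (a b : int) : (0 < n)%N ->
  (forall r, ~~ (6 %| (a * u 0 r + b * v 0 r)%R)%Z) ->
  (forall x y : R, exists (r : 'I_n) (m : int), `|x * (u 0 r)%:~R + y * (v 0 r)%:~R - m%:~R| <= 6%:R^-1) ->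
  proper_subtorus (plane R u v) /\ D (plane R u v) = 3^-1.
Proof.
move=> n0 hab htight.
pose p := torus_proj (plane_pt u v (a%:~R / 6%:R) (b%:~R / 6%:R : R)).
have pU : plane R u v p by apply/planeP; do 2!eexists.
have far_p r : 6%:R^-1 <= circle_norm (p 0 r).
  rewrite mxE circle_norm_pi; apply: dist_int_ge => m; rewrite plane_ptE.
  have -> : a%:~R / 6%:R * (u 0 r)%:~R + b%:~R / 6%:R * (v 0 r)%:~R - m%:~R =
     6%:R^-1 * (a * u 0 r + b * v 0 r - 6 * m)%:~R :> R.
    by rewrite intrB intrD !intrM; field.
  rewrite normrM gtr0_norm ?invr_gt0 ?ltr0n // ler_pMr ?invr_gt0 ?ltr0n // -intr_norm ler1z.
  rewrite -gtz0_ge1 normr_gt0 subr_eq0; apply: contra (hab r) => /eqP ->.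
  exact: dvdz_mulr.
split.
  move=> /(_ _ pU)[r pr]; have := far_p r; rewrite pr -[0](@raddf0 R (circle R) \pi_(circle R)%qT).
  rewrite circle_norm_pi leNgt => /negP[]; apply: (le_lt_trans (dist_int_le 0 0)).
  by rewrite subr0 normr0 invr_gt0 ltr0n.
suff e : ML (plane R u v) = 6%:R^-1 by rewrite /D e; lra.
apply/eqP; rewrite eq_le; apply/andP; split.
  apply: ML_le; first by exists p.
  move=> _ /planeP[x [y ->]]; have [r [m hm]] := htight x y.
  rewrite min_norm_proj.
  have h := @bigmin_le_cond _ R 'I_n 2^-1 r xpredT (fun r => dist_int (plane_pt u v x y 0 r)) isT.
  apply: (le_trans h).
  by apply: (le_trans (dist_int_le _ m)); rewrite plane_ptE.
apply: (le_trans _ (min_norm_le_ML pU)); apply/bigmin_geP; split; last by move=> r _; apply: far_p.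
by rewrite lef_pV2 ?posrE ?ltr0n // ler_nat.
Qed.

Let away (x : R) := forall m : int, 6%:R^-1 < `|x - m%:~R|.

Lemma awayP (x : R) (m : int) : away x -> x < m%:~R - 6%:R^-1 \/ m%:~R + 6%:R^-1 < x.
Proof. by move=> /(_ m); rewrite ltr_normr => /orP[]; [right|left]; lra. Qed.

(** Reduces a case analysis on x to the unit interval. *)
Lemma away_frac (x : R) (k f : int) : away (k%:~R * x) -> away (k%:~R * (x - f%:~R)).
Proof. by move=> h m; have := h (m + k * f); rewrite intrD intrM; congr (_ < `|_|); ring. Qed.

Ltac split_at H m := let h := fresh in have h := awayP m H; move: h => [h|h]; try lra.

(** On the unit interval each of the five speeds keeps x out of explicit
    intervals; their union is the whole interval. *)
Lemma tight_A (x : R) : ~ [/\ away (1%:~R * x), away (2%:~R * x), away (3%:~R * x), away (4%:~R * x) & away (5%:~R * x)].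
Proof.
move=> [h1 h2 h3 h4 h5]; have /andP[] := Num.Theory.floor_itv x; set f := Num.floor x.
rewrite intrD => f1 f2.
have {}h1 := away_frac f h1; have {}h2 := away_frac f h2; have {}h3 := away_frac f h3.
have {}h4 := away_frac f h4; have {}h5 := away_frac f h5.
move: h1 h2 h3 h4 h5; have y0 : 0 <= x - f%:~R by lra.
have y1 : x - f%:~R < 1 by lra.
move: (x - f%:~R) y0 y1 => y y0 y1 h1 h2 h3 h4 h5.
(* The comparisons are ordered so that linear arithmetic closes most branches
   at once. *)
split_at h1 (0 : int); split_at h1 (1 : int); split_at h5 (1 : int); split_at h5 (4 : int);
split_at h4 (1 : int); split_at h4 (3 : int); split_at h3 (1 : int); split_at h3 (2 : int);
split_at h2 (1 : int); split_at h5 (2 : int); split_at h5 (3 : int).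
Qed.

Lemma tight_B (x : R) : ~ [/\ away (1%:~R * x), away (3%:~R * x), away (4%:~R * x), away (5%:~R * x) & away (9%:~R * x)].
Proof.
move=> [h1 h3 h4 h5 h9]; have /andP[] := Num.Theory.floor_itv x; set f := Num.floor x.
rewrite intrD => f1 f2.
have {}h1 := away_frac f h1; have {}h3 := away_frac f h3.
have {}h4 := away_frac f h4; have {}h5 := away_frac f h5; have {}h9 := away_frac f h9.
move: h1 h3 h4 h5 h9; have y0 : 0 <= x - f%:~R by lra.
have y1 : x - f%:~R < 1 by lra.
move: (x - f%:~R) y0 y1 => y y0 y1 h1 h3 h4 h5 h9.
split_at h1 (0 : int); split_at h1 (1 : int); split_at h5 (1 : int); split_at h5 (4 : int);
split_at h4 (1 : int); split_at h4 (3 : int); split_at h3 (1 : int); split_at h3 (2 : int);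
split_at h5 (2 : int); split_at h5 (3 : int); split_at h9 (4 : int); split_at h9 (5 : int);
split_at h4 (2 : int).
Qed.

(** In the unit square each form keeps (x, y) out of explicit strips;
    together the strips cover the square. *)
Lemma tight_C (x y : R) : ~ ([/\ away x, away y & away (x + y)] /\
  [/\ away (2%:R * x + y), away (3%:R * x + y) & away (3%:R * x + 2%:R * y)]).
Proof.
wlog [[x0 x1] [y0 y1]] : x y / (0 <= x /\ x < 1) /\ (0 <= y /\ y < 1).
  move=> H; have /andP[] := Num.Theory.floor_itv x; set f := Num.floor x; rewrite intrD => f1 f2.
  have /andP[] := Num.Theory.floor_itv y; set g := Num.floor y; rewrite intrD => g1 g2.
  move=> [[h1 h2 h3] [h4 h5 h6]]; apply: (H (x - f%:~R) (y - g%:~R)); first by split; split; lra.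
  split; split=> m.
  - by have := h1 (m + f); rewrite !intrD; congr (_ < `|_|); ring.
  - by have := h2 (m + g); rewrite !intrD; congr (_ < `|_|); ring.
  - by have := h3 (m + f + g); rewrite !intrD; congr (_ < `|_|); ring.
  - by have := h4 (m + f + f + g); rewrite !intrD; congr (_ < `|_|); ring.
  - by have := h5 (m + f + f + f + g); rewrite !intrD; congr (_ < `|_|); ring.
  - by have := h6 (m + f + f + f + g + g); rewrite !intrD; congr (_ < `|_|); ring.
move=> [[h1 h2 h3] [h4 h5 h6]].
split_at h1 (0 : int); split_at h1 (1 : int); split_at h2 (0 : int); split_at h2 (1 : int);
split_at h3 (1 : int); split_at h4 (1 : int); split_at h4 (2 : int);
split_at h5 (1 : int); split_at h5 (2 : int); split_at h5 (3 : int);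
split_at h6 (1 : int); split_at h6 (2 : int); split_at h6 (3 : int); split_at h6 (4 : int).
Qed.
End Extremal.

(** * Two-dimensional subtori of the six-dimensional torus *)

Section Subtori.
Variable R : realType.

Lemma row6E w (i : nat) : (i < 6)%N -> row6 w 0 (inord i) = w`_i.
Proof. by move=> i6; rewrite mxE inordK. Qed.

Definition rows6 (K : seq (rat * rat)) (wu wv : seq int) :=
  size K = 6%N /\ all (fun i => nth 0 K i == ((wu`_i)%:~R, (wv`_i)%:~R)) (iota 0 6).

Lemma row6_columns K wu wv (r : 'I_6) : rows6 K wu wv -> nth 0 K r = column (row6 wu) (row6 wv) r.
Proof.
move=> [_ /allP h]; rewrite /column !mxE; apply/eqP; apply: h.
by rewrite mem_iota ltn_ord.
Qed.

(** If m were singular, all the columns of K would be proportional. *)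
Lemma equivalent_plane (u v : 'rV[int]_6) K wu wv : rows6 K wu wv ->
  (exists c d, [/\ c \in K, d \in K & c.1 * d.2 != c.2 * d.1]) ->
  equivalent (columns u v) K ->
  exists (s : 'S_6) (eps : {ffun 'I_6 -> bool}),
    signed_perm s eps @` plane R u v = plane R (row6 wu) (row6 wv).
Proof.
move=> hK [c [d [cK dK cd]]] /(equivalent_columns hK.1)[m [s [eps h]]].
exists s, eps; apply: (@signed_perm_plane R _ _ _ _ _ m); last by move=> r; rewrite -h (row6_columns r hK).
apply: contra cd => /eqP hm.
have lin0 x y : (lin m x).1 * (lin m y).2 = (lin m x).2 * (lin m y).1.
  move: m hm x y {h} => [[a b] [c' d']] /= hm [x1 x2] [y1 y2]; rewrite /lin /=.
  apply/eqP; rewrite -subr_eq0; apply/eqP.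
  have -> : (a * x1 + b * x2) * (c' * y1 + d' * y2) - (c' * x1 + d' * x2) * (a * y1 + b * y2) =
    (a * d' - b * c') * (x1 * y2 - x2 * y1) by ring.
  by rewrite hm subrr mul0r.
have hx x : x \in K -> exists e, x = lin m e \/ x = - lin m e.
  move=> /(nthP 0)[i]; rewrite hK.1 => i6 <-; have := h (Ordinal i6) => /= ->.
  by exists (column u v (s (Ordinal i6))); case: (eps _); [right|left].
have [[e [->|->]] [f [->|->]]] := (hx _ cK, hx _ dK).
- by rewrite lin0.
- by rewrite /= !mulrN lin0.
- by rewrite /= !mulNr lin0.
- by rewrite /= !mulrNN lin0.
Qed.

Lemma rows_A : rows6 columns_A [:: 1; 2; 3; 4; 5; 0] [:: 0; 0; 0; 0; 0; 1]. Proof. by split; vm_compute. Qed.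
Lemma rows_B : rows6 columns_B [:: 1; 3; 4; 5; 9; 0] [:: 0; 0; 0; 0; 0; 1]. Proof. by split; vm_compute. Qed.
Lemma rows_C : rows6 columns_C [:: 1; 0; 1; 2; 3; 3] [:: 0; 1; 1; 1; 1; 2]. Proof. by split; vm_compute. Qed.

Lemma classify_subtori U : subtorus2 U -> proper_subtorus U -> D U = 3^-1 ->
  exists (s : 'S_6) (eps : {ffun 'I_6 -> bool}),
  let V := signed_perm s eps @` U in V = U_A R \/ V = U_B R \/ V = U_C R.
Proof.
move=> [u [v [fuv ->]]] hp hD; have h0 := proper_columns hp.
have [|c /columnsP[r ->]|||] := classify_planes _ _ (free_minor fuv h0) (columns_no_lonely_point hD).
- by rewrite size_map size_enum_ord.
- exact: h0.
- move=> /(equivalent_plane rows_A)[|s [eps e]]; last by exists s, eps; left.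
  by exists (1, 0), (0, 1); split; vm_compute.
- move=> /(equivalent_plane rows_B)[|s [eps e]]; last by exists s, eps; right; left.
  by exists (1, 0), (0, 1); split; vm_compute.
- move=> /(equivalent_plane rows_C)[|s [eps e]]; last by exists s, eps; right; right.
  by exists (1, 0), (0, 1); split; vm_compute.
Qed.

Lemma free_rows6 wu wv (i j : nat) : (i < 6)%N -> (j < 6)%N ->
  wu`_i = 1 -> wv`_i = 0 -> wu`_j = 0 -> wv`_j = 1 ->
  free [:: real_row R (row6 wu); real_row R (row6 wv)].
Proof.
move=> i6 j6 ui vi uj vj; apply/free_pairP => x y /rowP e.
have := e (inord i); have := e (inord j).
rewrite !mxE !inordK // ui vi uj vj !mulr1 !mulr0 addr0 add0r.
by move=> -> ->.
Qed.

Lemma row6_intr (wu wv : seq int) (x y : R) (i : nat) : (i < 6)%N ->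
  x * (row6 wu 0 (inord i))%:~R + y * (row6 wv 0 (inord i))%:~R = x * (wu`_i)%:~R + y * (wv`_i)%:~R.
Proof. by move=> i6; rewrite !row6E. Qed.

Lemma tight_rows (wu wv : seq int) :
  (forall x y : R, ~ (forall i, (i < 6)%N -> forall m : int, 6%:R^-1 < `|x * (wu`_i)%:~R + y * (wv`_i)%:~R - m%:~R|)) ->
  forall x y : R, exists (r : 'I_6) (m : int),
   `|x * (row6 wu 0 r)%:~R + y * (row6 wv 0 r)%:~R - m%:~R| <= 6%:R^-1.
Proof.
move=> h x y; have /existsNP[i] := h x y => /not_implyP[i6 /existsNP[m /negP]].
by rewrite -leNgt => hm; exists (inord i), m; rewrite row6_intr.
Qed.

(** The points (1/6, 3/6) for the first two planes and (1/6, 2/6) for the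
    third have no coordinate congruent to 0 modulo 1. *)
Lemma planes_third (U : set (torus R 6)) : U = U_A R \/ U = U_B R \/ U = U_C R ->
  [/\ subtorus2 U, proper_subtorus U & D U = 3^-1].
Proof.
suff H wu wv (a b : int) i j : (i < 6)%N -> (j < 6)%N ->
    wu`_i = 1 -> wv`_i = 0 -> wu`_j = 0 -> wv`_j = 1 ->
    all (fun k => ~~ (6 %| (a * wu`_k + b * wv`_k)%R)%Z) (iota 0 6) ->
    (forall x y : R, ~ (forall i, (i < 6)%N -> forall m : int, 6%:R^-1 < `|x * (wu`_i)%:~R + y * (wv`_i)%:~R - m%:~R|)) ->
    U = plane R (row6 wu) (row6 wv) -> [/\ subtorus2 U, proper_subtorus U & D U = 3^-1].
  case=> [|[]].
  - apply: (H _ _ 1 3 0 5)%N => // x y h; apply: (@tight_A _ x).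
    by split=> m; [have := h 0 isT m|have := h 1 isT m|have := h 2 isT m|have := h 3 isT m|have := h 4 isT m];
      rewrite /= mulr0 addr0 mulrC.
  - apply: (H _ _ 1 3 0 5)%N => // x y h; apply: (@tight_B _ x).
    by split=> m; [have := h 0 isT m|have := h 1 isT m|have := h 2 isT m|have := h 3 isT m|have := h 4 isT m];
      rewrite /= mulr0 addr0 mulrC.
  - apply: (H _ _ 1 2 0 1)%N => // x y h; apply: (@tight_C _ x y).
    split; split=> m; [have := h 0 isT m|have := h 1 isT m|have := h 2 isT m|have := h 3 isT m|have := h 4 isT m|have := h 5 isT m];
      rewrite /=; congr (_ < `|_|); ring.
move=> i6 j6 ui vi uj vj hab ht ->.
have [|hp hD] := @D_third R 6 (row6 wu) (row6 wv) a b isT _ (tight_rows ht).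
  by move=> r; rewrite !mxE; apply: (allP hab); rewrite mem_iota ltn_ord.
split=> //; exists (row6 wu), (row6 wv); split=> //.
exact: free_rows6 i6 j6 ui vi uj vj.
Qed.
End Subtori.

Theorem theoremA (R : realType) :
  (forall U : set (torus R 6), U = U_A R \/ U = U_B R \/ U = U_C R ->
     [/\ subtorus2 U, proper_subtorus U & D U = 3^-1]) /\
  (forall U : set (torus R 6),
     subtorus2 U -> proper_subtorus U -> D U = 3^-1 ->
     exists (s : 'S_6) (eps : {ffun 'I_6 -> bool}),
       let V := signed_perm s eps @` U in
       V = U_A R \/ V = U_B R \/ V = U_C R).
Proof. by split; [exact: planes_third | exact: classify_subtori]. Qed.
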